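(* Let $\mathbf{A}\in\mathbb{H}^{m\times n}$, $\mathbf{B}\in\mathbb{H}^{p\times q}$, $\mathbf{D}\in\mathbb{H}^{m\times q}$, and let $\mathbf{X}_{LS}=(x_{ij})\in\mathbb{H}^{n\times p}$ be the minimum norm least squares solution of the matrix equation $\mathbf{A}\mathbf{X}\mathbf{B}=\mathbf{D}$ (unknown $\mathbf{X}\in\mathbb{H}^{n\times p}$). Put $\widetilde{\mathbf{D}}:=\mathbf{A}^{*}\mathbf{D}\mathbf{B}^{*}\in\mathbb{H}^{n\times p}$, with $k$th row $\tilde{\mathbf{d}}_{k.}$ ($k=1,\dots,n$) and $l$th column $\tilde{\mathbf{d}}_{.l}$ ($l=1,\dots,p$). Ranks $r_1,r_2$ below are assumed $\ge 1$. All formulas hold for all $i=1,\dots,n$, $j=1,\dots,p$. (i) If $\operatorname{rank}\mathbf{A}=r_1<m$ and $\operatorname{rank}\mathbf{B}=r_2<p$, then $$x_{ij}=\frac{\sum_{\beta\in J_{r_1,n}\{i\}}\operatorname{cdet}_i\left(\left((\mathbf{A}^{*}\mathbf{A})_{.i}(\mathbf{d}^{\mathbf{B}}_{.j})\right)_\beta^\beta\right)}{\sum_{\beta\in J_{r_1,n}}\left|(\mathbf{A}^{*}\mathbf{A})_\beta^\beta\right|\;\sum_{\alpha\in I_{r_2,p}}\left|(\mathbf{B}\mathbf{B}^{*})_\alpha^\alpha\right|}$$ and also $$x_{ij}=\frac{\sum_{\alpha\in I_{r_2,p}\{j\}}\operatorname{rdet}_j\left(\left((\mathbf{B}\mathbf{B}^{*})_{j.}(\mathbf{d}^{\mathbf{A}}_{i.})\right)_\alpha^\alpha\right)}{\sum_{\beta\in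 J_{r_1,n}}\left|(\mathbf{A}^{*}\mathbf{A})_\beta^\beta\right|\;\sum_{\alpha\in I_{r_2,p}}\left|(\mathbf{B}\mathbf{B}^{*})_\alpha^\alpha\right|},$$ where $\mathbf{d}^{\mathbf{B}}_{.j}\in\mathbb{H}^{n\times 1}$ is the column vector whose $k$th entry ($k=1,\dots,n$) is $$\sum_{\alpha\in I_{r_2,p}\{j\}}\operatorname{rdet}_j\left(\left((\mathbf{B}\mathbf{B}^{*})_{j.}(\tilde{\mathbf{d}}_{k.})\right)_\alpha^\alpha\right),\qquad(\mathrm{a})$$ and $\mathbf{d}^{\mathbf{A}}_{i.}\in\mathbb{H}^{1\times p}$ is the row vector whose $l$th entry ($l=1,\dots,p$) is $$\sum_{\beta\in J_{r_1,n}\{i\}}\operatorname{cdet}_i\left(\left((\mathbf{A}^{*}\mathbf{A})_{.i}(\tilde{\mathbf{d}}_{.l})\right)_\beta^\beta\right).\qquad(\mathrm{b})$$ (ii) If $\operatorname{rank}\mathbf{A}=n$ and $\operatorname{rank}\mathbf{B}=p$, then $$x_{ij}=\frac{\operatorname{cdet}_i\left((\mathbf{A}^{*}\mathbf{A})_{.i}(\mathbf{d}^{\mathbf{B}}_{.j})\right)}{\det(\mathbf{A}^{*}\mathbf{A})\cdot\det(\mathbf{B}\mathbf{B}^{*})}\quad\text{and also}\quad x_{ij}=\frac{\operatorname{rdet}_j\left((\mathbf{B}\mathbf{B}^{*})_{j.}(\mathbf{d}^{\mathbf{A}}_{i.})\right)}{\det(\mathbf{A}^{*}\mathbf{A})\cdot\det(\mathbf{B}\mathbf{B}^{*})},$$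 where now $$\mathbf{d}^{\mathbf{B}}_{.j}=\left(\operatorname{rdet}_j\left((\mathbf{B}\mathbf{B}^{*})_{j.}(\tilde{\mathbf{d}}_{1.})\right),\dots,\operatorname{rdet}_j\left((\mathbf{B}\mathbf{B}^{*})_{j.}(\tilde{\mathbf{d}}_{n.})\right)\right)^{T},\qquad(\mathrm{c})$$ $$\mathbf{d}^{\mathbf{A}}_{i.}=\left(\operatorname{cdet}_i\left((\mathbf{A}^{*}\mathbf{A})_{.i}(\tilde{\mathbf{d}}_{.1})\right),\dots,\operatorname{cdet}_i\left((\mathbf{A}^{*}\mathbf{A})_{.i}(\tilde{\mathbf{d}}_{.p})\right)\right).\qquad(\mathrm{d})$$ (iii) If $\operatorname{rank}\mathbf{A}=n$ and $\operatorname{rank}\mathbf{B}=r_2<p$, then $$x_{ij}=\frac{\operatorname{cdet}_i\left((\mathbf{A}^{*}\mathbf{A})_{.i}(\mathbf{d}^{\mathbf{B}}_{.j})\right)}{\det(\mathbf{A}^{*}\mathbf{A})\sum_{\alpha\in I_{r_2,p}}\left|(\mathbf{B}\mathbf{B}^{*})_\alpha^\alpha\right|}\quad\text{and also}\quad x_{ij}=\frac{\sum_{\alpha\in I_{r_2,p}\{j\}}\operatorname{rdet}_j\left(\left((\mathbf{B}\mathbf{B}^{*})_{j.}(\mathbf{d}^{\mathbf{A}}_{i.})\right)_\alpha^\alpha\right)}{\det(\mathbf{A}^{*}\mathbf{A})\sum_{\alpha\in I_{r_2,p}}\left|(\mathbf{B}\mathbf{B}^{*})_\alpha^\alpha\right|},$$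 where $\mathbf{d}^{\mathbf{B}}_{.j}$ is the column vector with entries (a) and $\mathbf{d}^{\mathbf{A}}_{i.}$ is the row vector (d). (iiii) If $\operatorname{rank}\mathbf{A}=r_1<n$ and $\operatorname{rank}\mathbf{B}=p$, then $$x_{ij}=\frac{\operatorname{rdet}_j\left((\mathbf{B}\mathbf{B}^{*})_{j.}(\mathbf{d}^{\mathbf{A}}_{i.})\right)}{\sum_{\beta\in J_{r_1,n}}\left|(\mathbf{A}^{*}\mathbf{A})_\beta^\beta\right|\cdot\det(\mathbf{B}\mathbf{B}^{*})}\quad\text{and also}\quad x_{ij}=\frac{\sum_{\beta\in J_{r_1,n}\{i\}}\operatorname{cdet}_i\left(\left((\mathbf{A}^{*}\mathbf{A})_{.i}(\mathbf{d}^{\mathbf{B}}_{.j})\right)_\beta^\beta\right)}{\sum_{\beta\in J_{r_1,n}}\left|(\mathbf{A}^{*}\mathbf{A})_\beta^\beta\right|\cdot\det(\mathbf{B}\mathbf{B}^{*})},$$ where $\mathbf{d}^{\mathbf{B}}_{.j}$ is the column vector (c) and $\mathbf{d}^{\mathbf{A}}_{i.}$ is the row vector with entries (b).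
   Context: $\mathbb{H}$ is the skew field of real (Hamilton) quaternions, $\mathbb{H}^{m\times n}$ the set of $m\times n$ quaternion matrices, $\mathbf{A}^{*}$ the conjugate transpose of $\mathbf{A}$, $\|\cdot\|$ the Frobenius norm. The rank is the usual rank of a quaternion matrix (dimension of the right column space). Minimum norm least squares solution: let $H_D=\{\mathbf{X}\in\mathbb{H}^{n\times p}: \|\mathbf{A}\mathbf{X}\mathbf{B}-\mathbf{D}\|=\min\}$ be the set of minimizers of $\|\mathbf{A}\mathbf{X}\mathbf{B}-\mathbf{D}\|$ over $\mathbb{H}^{n\times p}$ (the least squares solutions). $\mathbf{X}_{LS}$ is the element of $H_D$ of smallest Frobenius norm. Column and row determinants. Let $\mathbf{M}=(m_{ij})\in\mathbb{H}^{n\times n}$ and let $S_n$ be the symmetric group on $\{1,\dots,n\}$. All permutations are written as products of disjoint cycles, with fixed points included as cycles of length one, and $r$ denotes the number of cycles. The $i$th row determinant is $$\operatorname{rdet}_i\mathbf{M}=\sum_{\sigma\in S_n}(-1)^{n-r}m_{i\,i_{k_1}}m_{i_{k_1}i_{k_1+1}}\cdots m_{i_{k_1+l_1}\,i}\cdots m_{i_{k_r}i_{k_r+1}}\cdots m_{i_{k_r+l_r}i_{k_r}},$$ where $\sigma=(i\,i_{k_1}i_{k_1+1}\dots i_{k_1+l_1})(i_{k_2}i_{k_2+1}\dots i_{k_2+l_2})\cdots(i_{k_r}i_{k_r+1}\dots i_{k_r+l_r})$ is written so that $i$ opens the first cycle from the left, $i_{k_2}<i_{k_3}<\dots<i_{k_r}$,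 and $i_{k_t}<i_{k_t+u}$ for all $t=2,\dots,r$, $u=1,\dots,l_t$. (If $i$ is a fixed point of $\sigma$, the first cycle contributes $m_{ii}$.) The $j$th column determinant is $$\operatorname{cdet}_j\mathbf{M}=\sum_{\tau\in S_n}(-1)^{n-r}m_{j_{k_r}j_{k_r+l_r}}\cdots m_{j_{k_r+1}j_{k_r}}\cdots m_{j\,j_{k_1+l_1}}\cdots m_{j_{k_1+1}j_{k_1}}m_{j_{k_1}j},$$ where $\tau=(j_{k_r+l_r}\dots j_{k_r+1}j_{k_r})\cdots(j_{k_2+l_2}\dots j_{k_2+1}j_{k_2})(j_{k_1+l_1}\dots j_{k_1+1}j_{k_1}j)$ is written so that $j$ opens the first cycle from the right, $j_{k_2}<j_{k_3}<\dots<j_{k_r}$, and $j_{k_t}<j_{k_t+u}$ for all $t=2,\dots,r$, $u=1,\dots,l_t$. (If $j$ is a fixed point of $\tau$, the first cycle contributes $m_{jj}$.) For Hermitian $\mathbf{M}$ all the $\operatorname{rdet}_i\mathbf{M}$ and $\operatorname{cdet}_i\mathbf{M}$ coincide and are real (known fact); the common value is denoted $\det\mathbf{M}$. Notation. $\mathbf{M}_{.i}(\mathbf{c})$ (resp. $\mathbf{M}_{j.}(\mathbf{c})$) is the matrix obtained from $\mathbf{M}$ by replacing its $i$th column by the column $\mathbf{c}$ (resp. its $j$th row by the row $\mathbf{c}$). For an index set $\beta$, $\mathbf{M}_\beta^\beta$ is the principal submatrix with rows and columns indexed by $\beta$; for Hermitian $\mathbf{M}$, $|\mathbf{M}_\beta^\beta|:=\det(\mathbf{M}_\beta^\beta)$.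 Both $I_{r,n}$ and $J_{r,n}$ denote the set of all strictly increasing sequences of $r$ integers from $\{1,\dots,n\}$ (identified with $r$-element subsets); $I_{r,n}\{j\}=\{\alpha\in I_{r,n}: j\in\alpha\}$ and $J_{r,n}\{i\}=\{\beta\in J_{r,n}: i\in\beta\}$. In $\operatorname{cdet}_i(\cdot)_\beta^\beta$ with $i\in\beta$ (resp. $\operatorname{rdet}_j(\cdot)_\alpha^\alpha$ with $j\in\alpha$), the rows and columns of the submatrix keep their original labels, so that the column (row) determinant is taken along the column (row) coming from the $i$th column ($j$th row) of the full matrix. *)

(* Defs.v *)
From HB Require Import structures.
From mathcomp Require Import all_boot all_order perm all_algebra.
From mathcomp Require Import ring lra.
From mathcomp Require Import reals.

Set Implicit Arguments.
Unset Strict Implicit.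
Unset Printing Implicit Defensive.

Import Order.TTheory GRing.Theory Num.Theory.
Local Open Scope ring_scope.

(** * Hamilton quaternions *)

(* [Quat a b c d] is a + b i + c j + d k. *)
Record quat (R : Type) : Type := Quat { q1 : R; qi : R; qj : R; qk : R }.

Definition quat_tuple (R : Type) (x : quat R) : R * R * R * R :=
  (q1 x, qi x, qj x, qk x).
Definition tuple_quat (R : Type) (t : R * R * R * R) : quat R :=
  let: (a, b, c, d) := t in Quat a b c d.

Lemma quat_tupleK (R : Type) : cancel (@quat_tuple R) (@tuple_quat R).
Proof. by case. Qed.

HB.instance Definition _ (R : eqType) :=
  Equality.copy (quat R) (can_type (@quat_tupleK R)).
HB.instance Definition _ (R : choiceType) :=
  Choice.copy (quat R) (can_type (@quat_tupleK R)).

Section QuatRing.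
Variable R : comNzRingType.
Implicit Types x y z : quat R.

Definition quat0 : quat R := Quat 0 0 0 0.
Definition quat1 : quat R := Quat 1 0 0 0.
Definition oppq x : quat R := Quat (- q1 x) (- qi x) (- qj x) (- qk x).
Definition addq x y : quat R :=
  Quat (q1 x + q1 y) (qi x + qi y) (qj x + qj y) (qk x + qk y).
Definition mulq x y : quat R :=
  Quat (q1 x * q1 y - qi x * qi y - qj x * qj y - qk x * qk y)
       (q1 x * qi y + qi x * q1 y + qj x * qk y - qk x * qj y)
       (q1 x * qj y - qi x * qk y + qj x * q1 y + qk x * qi y)
       (q1 x * qk y + qi x * qj y - qj x * qi y + qk x * q1 y).

Fact addqA : associative addq.
Proof. by case=> ? ? ? ? [? ? ? ?] [? ? ? ?]; congr Quat => /=; ring. Qed.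
Fact addqC : commutative addq.
Proof. by case=> ? ? ? ? [? ? ? ?]; congr Quat => /=; ring. Qed.
Fact add0q : left_id quat0 addq.
Proof. by case=> ? ? ? ?; congr Quat => /=; ring. Qed.
Fact addNq : left_inverse quat0 oppq addq.
Proof. by case=> ? ? ? ?; congr Quat => /=; ring. Qed.

HB.instance Definition _ :=
  GRing.isZmodule.Build (quat R) addqA addqC add0q addNq.

Fact mulqA : associative mulq.
Proof. by case=> ? ? ? ? [? ? ? ?] [? ? ? ?]; congr Quat => /=; ring. Qed.
Fact mul1q : left_id quat1 mulq.
Proof. by case=> ? ? ? ?; congr Quat => /=; ring. Qed.
Fact mulq1 : right_id quat1 mulq.
Proof. by case=> ? ? ? ?; congr Quat => /=; ring. Qed.
Fact mulqDl : left_distributive mulq addq.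
Proof. by case=> ? ? ? ? [? ? ? ?] [? ? ? ?]; congr Quat => /=; ring. Qed.
Fact mulqDr : right_distributive mulq addq.
Proof. by case=> ? ? ? ? [? ? ? ?] [? ? ? ?]; congr Quat => /=; ring. Qed.
Fact quat1_neq0 : quat1 != quat0.
Proof. by apply/eqP => -[] /eqP; rewrite oner_eq0. Qed.

HB.instance Definition _ :=
  GRing.Zmodule_isNzRing.Build (quat R) mulqA mul1q mulq1 mulqDl mulqDr
    quat1_neq0.

Definition conjq x : quat R := Quat (q1 x) (- qi x) (- qj x) (- qk x).

Definition sqnormq x : R := q1 x ^+ 2 + qi x ^+ 2 + qj x ^+ 2 + qk x ^+ 2.

End QuatRing.

Section QuatInverse.
Variable R : realFieldType.
Implicit Types x y : quat R.

Definition invq x : quat R :=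
  let s := sqnormq x in
  Quat (q1 x / s) (- qi x / s) (- qj x / s) (- qk x / s).

Fact sqnormq_eq0 x : (sqnormq x == 0) = (x == 0).
Proof.
apply/idP/eqP => [|->]; last by rewrite /sqnormq /= !expr0n /= !addr0.
case: x => a b c d; rewrite /sqnormq /=.
rewrite !paddr_eq0 ?addr_ge0 ?sqr_ge0 // !sqrf_eq0.
by move=> /andP[/andP[/andP[/eqP-> /eqP->] /eqP->] /eqP->].
Qed.

Fact mulVq : {in predC1 (0 : quat R), left_inverse 1 invq *%R}.
Proof.
move=> x; rewrite inE -sqnormq_eq0; case: x => a b c d; rewrite /sqnormq /= => s0.
by congr Quat; rewrite /= /sqnormq /=; field.
Qed.

Fact mulqV : {in predC1 (0 : quat R), right_inverse 1 invq *%R}.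
Proof.
move=> x; rewrite inE -sqnormq_eq0; case: x => a b c d; rewrite /sqnormq /= => s0.
by congr Quat; rewrite /= /sqnormq /=; field.
Qed.

Fact unitqP x y : y * x = 1 /\ x * y = 1 -> predC1 (0 : quat R) x.
Proof.
case=> yx1 _; apply/eqP => x0; move: yx1; rewrite x0 mulr0 => /esym/eqP.
by rewrite oner_eq0.
Qed.

Fact invq_out : {in [predC predC1 (0 : quat R)], invq =1 id}.
Proof.
by move=> x; rewrite !inE negbK => /eqP->; congr Quat; rewrite /= ?oppr0 mul0r.
Qed.

HB.instance Definition _ :=
  GRing.NzRing_hasMulInverse.Build (quat R) mulVq mulqV unitqP invq_out.

End QuatInverse.

(** * Quaternion matrices: conjugate transpose, rank, least squares *)

Definition ctrmx (R : comNzRingType) m n (A : 'M[quat R]_(m, n)) :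
    'M[quat R]_(n, m) :=
  map_mx (@conjq R) A^T.

(* In [B *m x] the coefficients x multiply the columns of B on the right, so
   this says that A has a right column space of dimension r, with the columns
   of B as a basis. *)
Definition has_rank (R : comNzRingType) m n (A : 'M[quat R]_(m, n)) (r : nat) :=
  exists B : 'M[quat R]_(m, r),
    (forall x : 'cV_r, B *m x = 0 -> x = 0) /\
    (forall v : 'cV_m, (exists x : 'cV_r, v = B *m x) <->
                       (exists y : 'cV_n, v = A *m y)).

Definition frob (R : realType) m n (A : 'M[quat R]_(m, n)) : R :=
  Num.sqrt (\sum_i \sum_j sqnormq (A i j)).

Definition is_LS (R : realType) m n p q (A : 'M[quat R]_(m, n))
    (B : 'M[quat R]_(p, q)) (D : 'M[quat R]_(m, q)) (X : 'M[quat R]_(n, p)) :=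
  forall Y : 'M[quat R]_(n, p),
    frob (A *m X *m B - D) <= frob (A *m Y *m B - D).

Definition is_min_norm_LS (R : realType) m n p q (A : 'M[quat R]_(m, n))
    (B : 'M[quat R]_(p, q)) (D : 'M[quat R]_(m, q)) (X : 'M[quat R]_(n, p)) :=
  is_LS A B D X /\
  forall Y : 'M[quat R]_(n, p), is_LS A B D Y -> frob X <= frob Y.

(** * Row and column determinants *)

Section RowColDet.
Variable S : nzRingType.

(* The openers of the cycles of s : first i, then, in increasing order, the
   least elements of the cycles that do not contain i. *)
Definition cycle_heads n (s : 'S_n) (i : 'I_n) : seq 'I_n :=
  i :: [seq x <- enum 'I_n |
         (x \notin porbit s i) && [forall y in porbit s x, (x <= y)%N]].

(* M_(x, s x) M_(s x, s (s x)) ... M_(s^-1 x, x), in this order. *)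
Definition cycle_prod n (M : 'M[S]_n) (s : 'S_n) (x : 'I_n) : S :=
  \prod_(y <- fingraph.orbit s x) M y (s y).

Definition rdet n (i : 'I_n) (M : 'M[S]_n) : S :=
  \sum_(s : 'S_n)
    (-1) ^+ (n - #|porbits s|) * \prod_(x <- cycle_heads s i) cycle_prod M s x.

(* Read from left to right, the factors of each cycle (j_(k+l) ... j_(k+1) j_k)
   in the definition of cdet are M_(j_k, j_(k+l)) ... M_(j_(k+1), j_k), where s
   maps j_k to j_(k+l), ..., j_(k+1) to j_k: this is again [cycle_prod M s j_k].
   Only the order of the cycles differs from rdet: that of j comes last. *)
Definition cdet n (j : 'I_n) (M : 'M[S]_n) : S :=
  \sum_(s : 'S_n)
    (-1) ^+ (n - #|porbits s|) *
      \prod_(x <- rev (cycle_heads s j)) cycle_prod M s x.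

(* The determinant of a Hermitian quaternion matrix: all its row and column
   determinants are equal, so the first row determinant is their common value.
   It is only meaningful for Hermitian matrices. *)
Definition hdet n : 'M[S]_n -> S :=
  if n is n'.+1 return 'M[S]_n -> S then rdet ord0 else fun=> 1.

Definition setcol m n (i : 'I_n) (c : 'cV[S]_m) (M : 'M[S]_(m, n)) :
    'M[S]_(m, n) :=
  \matrix_(k, l) (if l == i then c k 0 else M k l).

Definition setrow m n (j : 'I_m) (c : 'rV[S]_n) (M : 'M[S]_(m, n)) :
    'M[S]_(m, n) :=
  \matrix_(k, l) (if k == j then c 0 l else M k l).

(* [enum_val] enumerates b in increasing order. *)
Definition psubmx n (b : {set 'I_n}) (M : 'M[S]_n) : 'M[S]_#|b| :=
  mxsub (@enum_val _ (mem b)) (@enum_val _ (mem b)) M.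

(* For i in b, the row determinant of the principal submatrix of M on b along
   the row of that submatrix that comes from row i of M; a dummy value if i is
   not in b. Likewise for [cdet_sub]. *)
Definition rdet_sub n (b : {set 'I_n}) (i : 'I_n) (M : 'M[S]_n) : S :=
  if @idP (i \in b) is ReflectT ib then rdet (enum_rank_in ib i) (psubmx b M)
  else 0.

Definition cdet_sub n (b : {set 'I_n}) (i : 'I_n) (M : 'M[S]_n) : S :=
  if @idP (i \in b) is ReflectT ib then cdet (enum_rank_in ib i) (psubmx b M)
  else 0.

End RowColDet.

(* I_{r,n} = J_{r,n}, and I_{r,n}{i} = J_{r,n}{i}. *)
Definition idx r n : {set {set 'I_n}} := [set b : {set 'I_n} | #|b| == r].
Definition idx_at r n (i : 'I_n) : {set {set 'I_n}} :=
  [set b : {set 'I_n} | (#|b| == r) && (i \in b)].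

Section Vectors.
Variables (S : nzRingType) (n p : nat).

(* Below, G stands for BB* in dB and dBfull, and for A*A in dA and dAfull; Dt
   stands for A*DB*. *)
Definition dB (r : nat) (G : 'M[S]_p) (Dt : 'M[S]_(n, p)) (j : 'I_p) : 'cV[S]_n :=
  \col_k \sum_(a in idx_at r j) rdet_sub a j (setrow j (row k Dt) G).

Definition dA (r : nat) (G : 'M[S]_n) (Dt : 'M[S]_(n, p)) (i : 'I_n) : 'rV[S]_p :=
  \row_l \sum_(b in idx_at r i) cdet_sub b i (setcol i (col l Dt) G).

Definition dBfull (G : 'M[S]_p) (Dt : 'M[S]_(n, p)) (j : 'I_p) : 'cV[S]_n :=
  \col_k rdet j (setrow j (row k Dt) G).

Definition dAfull (G : 'M[S]_n) (Dt : 'M[S]_(n, p)) (i : 'I_n) : 'rV[S]_p :=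
  \row_l cdet i (setcol i (col l Dt) G).

End Vectors.

(* Main.v *)
(* Write G = A^*A and let adj M be the matrix with entries
   cdet_i (M_.i(e_k)), so that cdet_i (M_.i(c)) = (adj M c)_i.

   For Hermitian M, averaging over the reversal of one cycle of a permutation
   replaces the product along this cycle by its real part, whatever the order
   of the factors: all row and column determinants of M are one real number
   det M. Merging and splitting the cycles of i and k shows that a Hermitian
   matrix with column i replaced by column k has a zero i-th column
   determinant, so adj M M = det M, and expresses the off-diagonal entries of
   adj M by bordered minors. Hence, if R_r sums the adjugates of the principal
   submatrices of order r of G and d_r sums the principal minors of order r,
   then R_(r+1) + R_r G = d_r (Faddeev-LeVerrier).

   A principal minor of G is positive if the corresponding columns of A are
   independent and zero otherwise, so for r = rank A one has d_r > 0 and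
   d_k = 0 for k > r. The recursion then gives R_k G = 0 for k > r, and
   R_r G A^* = d_r A^*, i.e. R_r G / d_r is a projection on the range of A^*.
   With H = BB^*, S = R_(rank B) for H and e the sum of the principal minors of
   order rank B of H, a minimum norm least squares solution X satisfies
   G X H = A^*DB^*, R_r G X = d_r X and X H S^* = e X. Hence
   R_r A^*DB^* S^* = d_r e X, and the entries of the left-hand side are the
   numerators of the theorem. *)

From HB Require Import structures.
Require Import Defs.
From mathcomp Require Import all_boot all_order fingroup perm all_algebra.
From mathcomp Require Import ring lra.
From mathcomp Require Import zify.
From mathcomp Require Import reals.

Set Implicit Arguments.
Unset Strict Implicit.
Unset Printing Implicit Defensive.

Import Order.TTheory GRing.Theory Num.Theory.
Local Open Scope ring_scope.

(** * Quaternion arithmetic: conjugation, real part, embedding of the reals *)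

Section Quaternions.
Variable R : comNzRingType.
Implicit Types x y : quat R.

Definition realq (a : R) : quat R := Quat a 0 0 0.

Lemma conjq_is_zmod_morphism : zmod_morphism (@conjq R).
Proof. by case=> ? ? ? ? [? ? ? ?]; congr Quat => /=; ring. Qed.
HB.instance Definition _ :=
  GRing.isZmodMorphism.Build (quat R) (quat R) (@conjq R) conjq_is_zmod_morphism.

Lemma q1_is_zmod_morphism : zmod_morphism (@q1 R).
Proof. by case=> ? ? ? ? [? ? ? ?]. Qed.
HB.instance Definition _ :=
  GRing.isZmodMorphism.Build (quat R) R (@q1 R) q1_is_zmod_morphism.

Lemma realq_is_zmod_morphism : zmod_morphism realq.
Proof. by move=> a b; congr Quat => /=; ring. Qed.
HB.instance Definition _ :=
  GRing.isZmodMorphism.Build R (quat R) realq realq_is_zmod_morphism.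

Lemma realq_is_monoid_morphism : monoid_morphism realq.
Proof. by split=> // a b; congr Quat => /=; ring. Qed.
HB.instance Definition _ :=
  GRing.isMonoidMorphism.Build R (quat R) realq realq_is_monoid_morphism.

Lemma realqC a x : realq a * x = x * realq a.
Proof. by case: x => ? ? ? ?; congr Quat => /=; ring. Qed.

Lemma realq_inj : injective realq.
Proof. by move=> a b []. Qed.

Lemma q1_realqM a x : q1 (realq a * x) = a * q1 x.
Proof. by case: x => ? ? ? ? /=; ring. Qed.

Lemma conjqK : involutive (@conjq R).
Proof. by case=> ? ? ? ?; congr Quat => /=; ring. Qed.

Lemma conjqM x y : conjq (x * y) = conjq y * conjq x.
Proof. by case: x y => ? ? ? ? [? ? ? ?]; congr Quat => /=; ring. Qed.

Lemma conjq1 : conjq (1 : quat R) = 1.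
Proof. by congr Quat => /=; ring. Qed.

Lemma conjq_realq a : conjq (realq a) = realq a.
Proof. by congr Quat => /=; ring. Qed.

Lemma addq_conj x : x + conjq x = realq (q1 x *+ 2).
Proof. by case: x => ? ? ? ?; congr Quat => /=; ring. Qed.

Lemma mulq_conj x : x * conjq x = realq (sqnormq x).
Proof. by case: x => ? ? ? ?; congr Quat; rewrite /sqnormq /=; ring. Qed.

Lemma mulq_conjl x : conjq x * x = realq (sqnormq x).
Proof. by case: x => ? ? ? ?; congr Quat; rewrite /sqnormq /=; ring. Qed.

Lemma q1_mulC x y : q1 (x * y) = q1 (y * x).
Proof. by case: x y => ? ? ? ? [? ? ? ?] /=; ring. Qed.

Lemma q1_conj x : q1 (conjq x) = q1 x. Proof. by []. Qed.

Lemma conjq_prod_seq (I : Type) (r : seq I) (F : I -> quat R) :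
  conjq (\prod_(x <- r) F x) = \prod_(x <- rev r) conjq (F x).
Proof.
elim: r => [|x r IH]; first by rewrite !big_nil conjq1.
by rewrite big_cons conjqM IH rev_cons big_rcons.
Qed.

Lemma conjq_sign k : conjq ((-1) ^+ k : quat R) = (-1) ^+ k.
Proof. by rewrite -(rmorph_sign realq) conjq_realq. Qed.

Lemma signqC k x : (-1) ^+ k * x = x * (-1) ^+ k.
Proof. by rewrite -(rmorph_sign realq) realqC. Qed.

End Quaternions.

(** Closes the averaging arguments: a sum is doubled, and one copy is reindexed by an involution. *)
Lemma addqq_inj (R : realFieldType) (x y : quat R) : x + x = y + y -> x = y.
Proof.
by case: x y => a b c d [a' b' c' d'] [] ? ? ? ?; congr Quat; lra.
Qed.

(** * Cycles of permutations: reversing one cycle, merging two *)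

Section Cycles.
Variables (n : nat).
Implicit Types (s : 'S_n) (x y : 'I_n).

(** Links the ordered cycle along which [cycle_prod] multiplies with the set [porbit], for which
    cycles are counted. *)
Lemma orbit_traject s x : fingraph.orbit s x = traject s x #|porbit s x|.
Proof.
rewrite /fingraph.orbit /order; congr (traject _ _ _); apply: eq_card => y.
rewrite inE; apply/idP/idP => [/iter_findex <-|/porbitP[i ->]].
  by rewrite -permX mem_porbit.
by rewrite permX fconnect_iter.
Qed.

Lemma mem_orbit_porbit s x : fingraph.orbit s x =i porbit s x.
Proof. by move=> y; rewrite orbit_traject porbit_traject. Qed.

Lemma porbit_step s x : porbit s (s x) = porbit s x.
Proof. by have := porbit_perm s 1 x; rewrite expg1. Qed.

Lemma mem_porbit_step s x y : (s y \in porbit s x) = (y \in porbit s x).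
Proof. by rewrite -!eq_porbit_mem porbit_step. Qed.

Lemma mem_porbitV s x y : ((s^-1)%g y \in porbit s x) = (y \in porbit s x).
Proof. by rewrite -[LHS]mem_porbit_step permKV. Qed.

Lemma porbit_eq s x y : y \in porbit s x -> porbit s y = porbit s x.
Proof. by move=> yx; apply/eqP; rewrite eq_porbit_mem. Qed.

Lemma eq_traject_porbit s s' x m :
    (forall y, y \in porbit s x -> s' y = s y) -> traject s' x m = traject s x m.
Proof.
elim: m x => //= m IHm x ss'; rewrite ss' ?porbit_id // IHm // => y.
by rewrite porbit_step => /ss'.
Qed.

Lemma eq_porbit s s' x :
    (forall y, y \in porbit s x -> s' y = s y) -> porbit s' x = porbit s x.
Proof.
move=> ss'; have E k : (s' ^+ k)%g x = (s ^+ k)%g x.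
  elim: k => [|k IHk]; first by rewrite !expg0 !perm1.
  by rewrite !expgSr !permM IHk ss' ?mem_porbit.
by apply/setP=> y; apply/porbitP/porbitP => -[k ->]; exists k; rewrite E.
Qed.

Lemma eq_orbit s s' x :
    (forall y, y \in porbit s x -> s' y = s y) ->
  fingraph.orbit s' x = fingraph.orbit s x.
Proof.
by move=> ss'; rewrite !orbit_traject (eq_porbit ss') (eq_traject_porbit _ ss').
Qed.

Definition revc_fun s x y := if y \in porbit s x then (s^-1)%g y else s y.

Lemma revc_fun_inj s x : injective (revc_fun s x).
Proof.
move=> y z; rewrite /revc_fun; case: ifPn => hy; case: ifPn => hz.
- by move/perm_inj.
- by move=> E; case/negP: hz; rewrite -mem_porbit_step -E mem_porbitV.
- by move=> E; case/negP: hy; rewrite -mem_porbit_step E mem_porbitV.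
- by move/perm_inj.
Qed.

(** The involution behind the averaging arguments. It keeps the partition into cycles, hence the
    sign and the least elements of the cycles. *)
Definition revc s x : 'S_n := perm (@revc_fun_inj s x).

Lemma revcE s x y : revc s x y = if y \in porbit s x then (s^-1)%g y else s y.
Proof. by rewrite permE. Qed.

Lemma revc_in s x y : y \in porbit s x -> revc s x y = (s^-1)%g y.
Proof. by rewrite revcE => ->. Qed.

Lemma revc_out s x y : y \notin porbit s x -> revc s x y = s y.
Proof. by rewrite revcE => /negPf->. Qed.

Lemma porbit_revc s x y : porbit (revc s x) y = porbit s y.
Proof.
have [yx|yx] := boolP (y \in porbit s x).
  rewrite -[RHS]porbitV; apply: eq_porbit => z; rewrite porbitV (porbit_eq yx).
  exact: revc_in.
apply: eq_porbit => z zy; apply: revc_out; apply: contra yx => zx.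
by rewrite -(porbit_eq zx) (porbit_eq zy) porbit_id.
Qed.

Lemma porbits_revc s x : porbits (revc s x) = porbits s.
Proof. by apply: eq_imset => y; apply: porbit_revc. Qed.

Lemma revcK s x : revc (revc s x) x = s.
Proof.
apply/permP=> y; rewrite [LHS]revcE porbit_revc; case: ifPn => yx.
  by apply/(canLR (permK _)); rewrite revc_in ?mem_porbit_step ?permK.
by rewrite revc_out.
Qed.

(** Only the two closing arrows change: the predecessor of [i] is now sent to [k], and that of [k]
    to [i]. The order of the list matters, as the products along it do not commute. *)
Lemma orbit_merge s i k : k \notin porbit s i ->
  fingraph.orbit (s * tperm i k)%g i =
    fingraph.orbit s i ++ fingraph.orbit s k.
Proof.
move=> ki; set t := (s * tperm i k)%g.
have neq : i != k by apply: contraNneq ki => ->; rewrite porbit_id.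
have pathE a m : (forall z, z \in traject s a m -> s z != i /\ s z != k) ->
    traject t a m.+1 = traject s a m.+1.
  elim: m a => //= m IHm a h; have [hi hk] := h a (mem_head _ _).
  have ta : t a = s a by rewrite permM tpermD // eq_sym.
  have hs z : z \in traject s (s a) m -> s z != i /\ s z != k.
    by move=> hz; apply: h; rewrite inE hz orbT.
  by have := IHm _ hs; rewrite ta => ->.
have orb a : (a == i) || (a == k) ->
    fpath t a (behead (fingraph.orbit s a)) /\
    last a (behead (fingraph.orbit s a)) = (s^-1)%g a.
  move=> ha; rewrite orbit_traject.
  have := uniq_traject_porbit s a; have := iter_porbit s a.
  case E : #|porbit s a| => [|m]; first by have := card_porbit_neq0 s a; rewrite E.
  move=> it un /=; split; last first.
    by rewrite last_traject; apply: (canRL (permK s)); rewrite -iterS.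
  apply/fpathP; exists m; suff [-> //] : traject t a m.+1 = traject s a m.+1.
  apply: pathE => z /trajectP[j jm ->]; rewrite -iterS.
  have inorb : iter j.+1 s a \in porbit s a by rewrite -permX mem_porbit.
  have nea : iter j.+1 s a != a.
    move: un; rewrite /= => /andP[+ _]; apply: contraNneq => e.
    by apply/trajectP; exists j => //; rewrite -iterSr; apply: esym e.
  case/orP: ha => /eqP ae; subst a; split=> //; apply: contraNneq ki.
    by move=> <-.
  by move=> e; rewrite porbit_sym -e.
have [|fi li] := orb i; first by rewrite eqxx.
have [|fk lk] := orb k; first by rewrite eqxx orbT.
have cons a : fingraph.orbit s a = a :: behead (fingraph.orbit s a).
  by rewrite orbit_traject; case E: #|_| (card_porbit_neq0 s a).
(* A duplicate-free closed path through [i] is the orbit of [i] up to rotation, by [orbitE]. *)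
have fc : fcycle t (fingraph.orbit s i ++ fingraph.orbit s k).
  rewrite (cons i) (cons k) /= -cats1 -catA cat_path fi /= li.
  rewrite permM permKV tpermL eqxx /= cat_path fk lk /= permM permKV tpermR.
  by rewrite eqxx.
rewrite (orbitE fc).
- by rewrite (cons i) /= eqxx rot0.
- rewrite cat_uniq !orbit_uniq andbT /=; apply/hasPn=> z.
  rewrite !mem_orbit_porbit => zk; apply: contra ki => zi.
  by rewrite -(porbit_eq zi) porbit_sym.
by rewrite mem_cat mem_orbit_porbit porbit_id.
Qed.

End Cycles.

(** * Products of matrix entries along a cycle *)

Section CycleProducts.
Variables (S : nzRingType) (n : nat).
Implicit Types (M : 'M[S]_n) (s : 'S_n) (x y i : 'I_n).

Lemma big_traject_ord (f : 'I_n -> 'I_n) x m (F : 'I_n -> S) :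
  \prod_(y <- traject f x m) F y = \prod_(j < m) F (iter j f x).
Proof.
elim: m x => [|m IHm] x; first by rewrite big_nil big_ord0.
rewrite /= big_cons big_ord_recl IHm; congr (_ * _).
by apply: eq_bigr => j _; rewrite -iterSr.
Qed.

Lemma cycle_prodE M s x : cycle_prod M s x =
  \prod_(j < #|porbit s x|) M ((s ^+ j)%g x) ((s ^+ j.+1)%g x).
Proof.
rewrite /cycle_prod orbit_traject big_traject_ord; apply: eq_bigr => j _.
by rewrite expgSr permM !permX.
Qed.

Lemma eq_cycle_prod M M' s s' x :
    (forall y, y \in porbit s x -> s' y = s y) ->
    (forall y, y \in porbit s x -> M' y (s y) = M y (s y)) ->
  cycle_prod M' s' x = cycle_prod M s x.
Proof.
move=> ss' MM'; rewrite /cycle_prod (eq_orbit ss') big_seq [RHS]big_seq.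
by apply: eq_bigr => y; rewrite mem_orbit_porbit => yx; rewrite ss' ?MM'.
Qed.

Lemma prod_seq_eq0 (I : eqType) (r : seq I) (F : I -> S) (z : I) :
  z \in r -> F z = 0 -> \prod_(x <- r) F x = 0.
Proof.
elim: r => //= a r IHr; rewrite inE big_cons => /orP[/eqP<- ->|zr Fz].
  by rewrite mul0r.
by rewrite IHr ?mulr0.
Qed.

Lemma cycle_prod_eq0 M s x y :
  y \in porbit s x -> M y (s y) = 0 -> cycle_prod M s x = 0.
Proof. by rewrite -mem_orbit_porbit; apply: prod_seq_eq0. Qed.

Lemma cycle_prod_fixed M s x : s x = x -> cycle_prod M s x = M x x.
Proof.
move=> sx; rewrite /cycle_prod (_ : fingraph.orbit s x = [:: x]) ?big_seq1 ?sx //.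
rewrite orbit_traject (_ : porbit s x = [set x]) ?cards1 //.
apply/setP=> y; rewrite inE; apply/porbitP/eqP => [[k ->]|->].
  elim: k => [|k IHk]; first by rewrite expg0 perm1.
  by rewrite expgSr permM IHk.
by exists 0%N; rewrite expg0 perm1.
Qed.

Lemma sign_porbits s : (-1) ^+ (n - #|porbits s|) = (-1) ^+ s :> S.
Proof.
rewrite -signr_odd oddB ?/odd_perm ?card_ord //.
by rewrite -[leqRHS](card_ord n) leq_imset_card.
Qed.

Lemma cycle_prod_revc_out M s x y : y \notin porbit s x ->
  cycle_prod M (revc s x) y = cycle_prod M s y.
Proof.
move=> yx; apply: eq_cycle_prod => // z zy; apply: revc_out.
by apply: contra yx => zx; rewrite -(porbit_eq zx) (porbit_eq zy) porbit_id.
Qed.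

End CycleProducts.


(** * Conjugates and real parts of cycle products *)

Section QuaternionCycles.
Variables (R : comNzRingType) (n : nat).
Implicit Types (M : 'M[quat R]_n) (s : 'S_n) (x y i : 'I_n).

Lemma ctrmxE m p (A : 'M[quat R]_(m, p)) j k : ctrmx A j k = conjq (A k j).
Proof. by rewrite !mxE. Qed.

Lemma ctrmxK m p : cancel (@ctrmx R m p) (@ctrmx R p m).
Proof. by move=> A; apply/matrixP=> j k; rewrite !ctrmxE conjqK. Qed.

Lemma conjq_prod_ord m (F : nat -> quat R) :
  conjq (\prod_(j < m) F j) = \prod_(j < m) conjq (F (m - j.+1)%N).
Proof.
elim: m => [|m IHm]; first by rewrite !big_ord0 conjq1.
by rewrite big_ord_recr conjqM IHm [RHS]big_ord_recl /= subSS subn0.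
Qed.

(** Conjugation reverses the order of the factors, so the cycle is read backwards, still starting
    from [x]. *)
Lemma conjq_cycle_prod M s x :
  conjq (cycle_prod M s x) = cycle_prod (ctrmx M) s^-1 x.
Proof.
rewrite !cycle_prodE porbitV.
rewrite (conjq_prod_ord _ (fun j => M ((s ^+ j)%g x) ((s ^+ j.+1)%g x))).
apply: eq_bigr => j _; rewrite ctrmxE; set N := #|_|.
have E k : (k <= N)%N -> (s ^+ (N - k))%g x = (s^-1 ^+ k)%g x.
  move=> kN; rewrite expgVn; apply: (canRL (permK (s ^+ k)%g)).
  by rewrite -permM -expgD subnK // permX iter_porbit.
by rewrite -!E ?ltn_ord ?(ltnW (ltn_ord _)) // subnSK ?ltn_ord.
Qed.

(** Symmetry is asked only on the cycle of [x], so that the lemma applies to a Hermitian matrix with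
    a replaced column that the cycle avoids. *)
Lemma cycle_prod_revc M s x :
    {in porbit s x &, forall y z, M z y = conjq (M y z)} ->
  cycle_prod M (revc s x) x = conjq (cycle_prod M s x).
Proof.
move=> hM; rewrite conjq_cycle_prod; apply: eq_cycle_prod => y.
  by rewrite porbitV => /revc_in.
by rewrite porbitV ctrmxE => yx; apply: hM; rewrite ?mem_porbitV.
Qed.

(** Since [q1 (x * y) = q1 (y * x)], the real part does not depend on the starting point: it is a
    weight of the cycle itself. *)
Definition wt M s x := q1 (cycle_prod M s x).

Lemma wt_step M s x : wt M s (s x) = wt M s x.
Proof.
rewrite /wt !cycle_prodE porbit_step.
have := iter_porbit s x; rewrite -permX.
have sS k : (s ^+ k)%g (s x) = (s ^+ k.+1)%g x by rewrite expgS permM.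
case: #|porbit s x| (card_porbit_neq0 s x) => // N _ sN.
rewrite big_ord_recr [X in _ = q1 X]big_ord_recl q1_mulC; congr (q1 (_ * _)).
  by rewrite /= !sS (expgSr s N.+1) permM sN expg0 perm1 expg1.
by apply: eq_bigr => j _; rewrite !sS.
Qed.

Lemma wt_porbit M s x y : y \in porbit s x -> wt M s y = wt M s x.
Proof.
case/porbitP=> k ->; elim: k => [|k IHk]; first by rewrite expg0 perm1.
by rewrite expgSr permM wt_step.
Qed.

Definition least s x := [forall y in porbit s x, (x <= y)%N].

Lemma least_uniq s x y : least s x -> least s y -> y \in porbit s x -> x = y.
Proof.
move=> /forall_inP hx /forall_inP hy yx; apply/val_inj/eqP.
by rewrite eqn_leq hx // hy // porbit_sym.
Qed.

Lemma least_exists s x : exists2 y, y \in porbit s x & least s y.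
Proof.
have xx := porbit_id s x.
case: (arg_minnP (fun y : 'I_n => y : nat) xx) => y yx ymin.
exists y => //; apply/forall_inP => z; rewrite (porbit_eq yx); exact: ymin.
Qed.

Lemma least_revc s x y : least (revc s x) y = least s y.
Proof. by rewrite /least porbit_revc. Qed.

Definition other_heads s i :=
  [seq x <- enum 'I_n | (x \notin porbit s i) && least s x].

Lemma other_heads_revc s x i : other_heads (revc s x) i = other_heads s i.
Proof.
by apply: eq_filter => y; rewrite porbit_revc least_revc.
Qed.

(** A product over least elements is a product over cycles. The least element of the cycle of [k]
    may differ from [k], but has the same weight. *)
Lemma prod_least_split M s k (Q : pred 'I_n) :
    {in porbit s k, forall x, Q x} ->
  \prod_(x | Q x && least s x) wt M s x =
    wt M s k * \prod_(x | [&& Q x, x \notin porbit s k & least s x]) wt M s x.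
Proof.
move=> Qk; have [y yk ly] := least_exists s k.
rewrite (bigD1 y) /= ?Qk // (wt_porbit _ yk); congr (_ * _).
apply: eq_bigl => x; case Qx: (Q x) => //=.
have [lx|] := boolP (least s x); last by rewrite andbF.
rewrite andbT /=; congr (~~ _); apply/eqP/idP => [->//|xk].
by apply/esym/(least_uniq ly lx); rewrite (porbit_eq yk).
Qed.

End QuaternionCycles.

(** * Replacing the products along the cycles that avoid [i] by their real parts *)

Section Realification.
Variables (R : realFieldType) (n : nat) (i : 'I_n) (M : 'M[quat R]_n).

Hypothesis M_herm : forall y z, y != i -> z != i -> M z y = conjq (M y z).

Let sgn (s : 'S_n) : quat R := (-1) ^+ (n - #|porbits s|).
Let rh s := rev (other_heads s i).

(** Interpolates between the summand of [cdet i M], at [m = 0], and its realified form: the [m]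
    leftmost cycles are already replaced by their weights. *)
Let partial_term m s := sgn s * (\prod_(x <- take m (rh s)) realq (wt M s x) *
  \prod_(x <- drop m (rh s)) cycle_prod M s x * cycle_prod M s i).

Let mem_rh s x : (x \in rh s) = (x \notin porbit s i) && least s x.
Proof. by rewrite mem_rev mem_filter mem_enum andbT. Qed.

(* Averaging over the reversal of one cycle replaces the product along this
   cycle by its real part. *)
Let partial_step m : \sum_s partial_term m s = \sum_s partial_term m.+1 s.
Proof.
(* Reverses cycle number [m] of the list, if there is one. The list of heads is unchanged, which
   makes [phi] an involution. *)
pose phi s := if (m < size (rh s))%N then revc s (nth i (rh s) m) else s.
have rh_phi s : rh (phi s) = rh s.
  by rewrite /phi; case: ifP => // _; rewrite /rh other_heads_revc.
have phiK : involutive phi.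
  move=> s; rewrite {1}/phi rh_phi /phi; case: ifP => lt; last by rewrite lt.
  by rewrite lt revcK.
suff E : \sum_s partial_term m s + \sum_s partial_term m s =
         \sum_s partial_term m.+1 s + \sum_s partial_term m.+1 s.
  exact: addqq_inj E.
rewrite {2}(reindex_inj (inv_inj phiK)) /= -!big_split /=; apply: eq_bigr => s _.
have [lt|ge] := ltnP m (size (rh s)); last first.
  rewrite /phi ltnNge ge /= /partial_term.
  by rewrite !take_oversize ?drop_oversize // leqW.
set x := nth i (rh s) m.
have phiE : phi s = revc s x by rewrite /phi lt.
have xrh : x \in rh s by rewrite mem_nth.
have un : uniq (rh s) by rewrite rev_uniq filter_uniq // enum_uniq.
have [xi lx] := andP (etrans (esym (mem_rh s x)) xrh).
have cycE y : y \in rh s -> y != x ->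
    cycle_prod M (revc s x) y = cycle_prod M s y.
  rewrite mem_rh => /andP[yi ly] neq; apply: cycle_prod_revc_out.
  by apply: contraNN neq => yx; apply/eqP/esym/(least_uniq lx ly).
have cyci : cycle_prod M (revc s x) i = cycle_prod M s i.
  by apply: cycle_prod_revc_out; rewrite porbit_sym.
have cycx : cycle_prod M (revc s x) x = conjq (cycle_prod M s x).
  have nx y : y \in porbit s x -> y != i.
    by move=> yx; apply: contraNneq xi => <-; rewrite porbit_sym.
  by apply: cycle_prod_revc => y z /nx yi /nx zi; apply: M_herm.
have nin : x \notin take m (rh s) /\ x \notin drop m.+1 (rh s).
  have := un; rewrite -{1}(cat_take_drop m (rh s)) (drop_nth i lt) -/x.
  rewrite cat_uniq /= => /and3P[_ + /andP[-> _]].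
  by rewrite negb_or => /andP[-> _].
rewrite /partial_term rh_phi phiE /sgn porbits_revc cyci.
rewrite (take_nth i lt) -/x (drop_nth i lt) -/x big_rcons !big_cons cycx.
have -> : \prod_(y <- take m (rh s)) realq (wt M (revc s x) y) =
          \prod_(y <- take m (rh s)) realq (wt M s y).
  rewrite big_seq [RHS]big_seq; apply: eq_bigr => y yin; rewrite /wt cycE //.
    exact: mem_take yin.
  by apply: contraTneq yin => ->; case: nin.
have -> : \prod_(y <- drop m.+1 (rh s)) cycle_prod M (revc s x) y =
          \prod_(y <- drop m.+1 (rh s)) cycle_prod M s y.
  rewrite big_seq [RHS]big_seq; apply: eq_bigr => y yin; rewrite cycE //.
    exact: mem_drop yin.
  by apply: contraTneq yin => ->; case: nin.
rewrite -!mulrDr -!mulrDl -!mulrDr -!mulrDl addq_conj /wt mulr2n raddfD /=.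
by rewrite !mulrDl !mulrDr !mulrDl !mulrDr !mulrA.
Qed.

Lemma cdet_realify : cdet i M = \sum_(s : 'S_n) (-1) ^+ (n - #|porbits s|) *
  (realq (\prod_(x | (x \notin porbit s i) && least s x) wt M s x) *
   cycle_prod M s i).
Proof.
transitivity (\sum_s partial_term 0 s).
  apply: eq_bigr => s _; rewrite /partial_term take0 drop0 big_nil mul1r.
  by rewrite /cycle_heads rev_cons big_rcons.
have step m : \sum_s partial_term 0 s = \sum_s partial_term m s.
  by elim: m => // m ->; apply: partial_step.
(* There are at most [n] other cycles, so after [n] steps all of them are replaced. *)
rewrite (step n).
apply: eq_bigr => s _; rewrite /partial_term; have szn : (size (rh s) <= n)%N.
  by rewrite size_rev size_filter (leq_trans (count_size _ _)) ?size_enum_ord.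
rewrite take_oversize // drop_oversize // big_nil mulr1 -rmorph_prod.
congr (_ * (realq _ * _)); rewrite (perm_big (other_heads s i)) ?perm_rev //=.
by rewrite big_filter big_enum_cond.
Qed.

End Realification.

(** * Determinant and adjugate of a Hermitian quaternion matrix *)

Section HermitianDeterminant.
Variables (R : realFieldType) (n : nat).
Implicit Types (M : 'M[quat R]_n) (s : 'S_n) (x y i k : 'I_n) (c : 'cV[quat R]_n).

Definition sgn s : R := (-1) ^+ s.

Lemma signq_porbits s : (-1) ^+ (n - #|porbits s|) = realq (sgn s).
Proof. by rewrite sign_porbits rmorph_sign. Qed.

Lemma sgn_revc s x : sgn (revc s x) = sgn s.
Proof. by rewrite /sgn /odd_perm porbits_revc. Qed.

(** The cycle count of [porbits_mul_tperm] is applied to a permutation and to its product with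
    [tperm k i]; as the two products undo each other, exactly one of the two permutations separates
    [i] and [k]. *)
Lemma mem_porbit_mul_tperm s i k : i != k ->
  (k \in porbit (s * tperm i k)%g i) = (k \notin porbit s i).
Proof.
move=> ik; pose u := (s^-1)%g.
have h v : (#|porbits (tperm k i * v)%g| + (k \notin porbit v i).*2 =
             #|porbits v| + 1)%N by rewrite porbits_mul_tperm eq_sym ik.
have := h u; have := h (tperm k i * u)%g; rewrite mulgA tperm2 mul1g.
have <- : ((s * tperm i k)^-1 = tperm k i * u)%g by rewrite invMg tpermV tpermC.
rewrite !porbitV; case: (k \in porbit s i); case: (k \in porbit _ i) => //=; lia.
Qed.

Lemma herm_entry M x y : ctrmx M = M -> M y x = conjq (M x y).
Proof. by move=> {1}<-; rewrite ctrmxE. Qed.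

Definition other_wt M s i := \prod_(x | (x \notin porbit s i) && least s x) wt M s x.

Lemma setcol_col M i : setcol i (col i M) M = M.
Proof. by apply/matrixP=> y z; rewrite !mxE; case: eqP => [->|]. Qed.

Lemma cycle_prod_setcol_out c M s i x : x \notin porbit s i ->
  cycle_prod (setcol i c M) s x = cycle_prod M s x.
Proof.
move=> xi; apply: eq_cycle_prod => // y yx; rewrite mxE ifN //.
apply: contraNneq xi => <-.
by rewrite porbit_step (porbit_eq yx) porbit_id.
Qed.

Lemma cdet_setcol M i c : ctrmx M = M ->
  cdet i (setcol i c M) =
  \sum_s realq (sgn s * other_wt M s i) * cycle_prod (setcol i c M) s i.
Proof.
move=> hM; rewrite cdet_realify => [|y z yi zi]; last first.
  by rewrite !mxE (negPf yi) (negPf zi) (herm_entry _ _ hM).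
apply: eq_bigr => s _; rewrite signq_porbits mulrA -rmorphM; congr (realq (_ * _) * _).
apply: eq_bigr => x /andP[xi _]; by rewrite /wt cycle_prod_setcol_out.
Qed.

Lemma other_wt_split M s i :
  \prod_(x | least s x) wt M s x = wt M s i * other_wt M s i.
Proof. exact: (prod_least_split M (Q := xpredT)). Qed.

(** Averaging over the reversal of the cycle of [k]: the two copies of each term add up to
    [x + conjq x], provided that the other factors are invariant. *)
Lemma sum_revc M k (P : pred 'S_n) (a : 'S_n -> R) (b : 'S_n -> quat R) :
    ctrmx M = M ->
    (forall s, P (revc s k) = P s) ->
    (forall s, P s -> a (revc s k) = a s) ->
    (forall s, P s -> b (revc s k) = b s) ->
  \sum_(s | P s) realq (a s) * (b s * cycle_prod M s k) =
  \sum_(s | P s) realq (a s * wt M s k) * b s.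
Proof.
move=> hM hP ha hb; apply: addqq_inj.
have kK : injective (fun s => revc s k) by apply: inv_inj => s; apply: revcK.
rewrite [X in _ + X = _](reindex_inj kK) /= [X in _ + X = _](eq_bigl P) //.
rewrite -!big_split /=; apply: eq_bigr => s Ps; rewrite ha // hb //.
rewrite cycle_prod_revc; last first.
  by move=> y z _ _; apply: herm_entry.
rewrite -!mulrDr addq_conj -/(wt M s k) mulr2n rmorphD rmorphM /= !mulrDr.
by rewrite -!mulrA (realqC (wt M s k)).
Qed.

(** The common value of the row and column determinants of a Hermitian matrix, in a form that
    singles out no index. *)
Definition hermdet M : R := \sum_s sgn s * \prod_(x | least s x) wt M s x.

Lemma other_wt_revc M s i k : k \in porbit s i ->
  other_wt M (revc s k) i = other_wt M s i.
Proof.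
move=> ki; apply: eq_big => [x|x]; first by rewrite porbit_revc least_revc.
rewrite porbit_revc /wt => /andP[xi _]; rewrite cycle_prod_revc_out //.
by rewrite (porbit_eq ki).
Qed.

Lemma cdet_herm M i : ctrmx M = M -> cdet i M = realq (hermdet M).
Proof.
move=> hM; rewrite -{1}(setcol_col M i) cdet_setcol // setcol_col.
transitivity (\sum_s realq (sgn s * other_wt M s i) * (1 * cycle_prod M s i)).
  by apply: eq_bigr => s _; rewrite mul1r.
rewrite (sum_revc (P := xpredT) (b := fun=> 1)) // => [|s _]; last first.
  by rewrite sgn_revc other_wt_revc ?porbit_id.
rewrite rmorph_sum; apply: eq_bigr => s _.
by rewrite mulr1 (other_wt_split M s i) mulrAC -mulrA.
Qed.

(** After reindexing by the inverse, which has the same heads, conjugation reverses both the order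
    of the cycles and each cycle. Results on [cdet] are carried to [rdet] in this way. *)
Lemma conjq_rdet M i : conjq (rdet i M) = cdet i (ctrmx M).
Proof.
rewrite /rdet raddf_sum [RHS](reindex_inj invg_inj); apply: eq_bigr => s _ /=.
rewrite conjqM conjq_sign -signqC porbitsV conjq_prod_seq; congr (_ * _).
have -> : cycle_heads s^-1 i = cycle_heads s i.
  by rewrite /cycle_heads; congr (_ :: _); apply: eq_filter => x; rewrite !porbitV.
by apply: eq_bigr => x _; rewrite conjq_cycle_prod.
Qed.

Lemma rdet_conj M i : rdet i M = conjq (cdet i (ctrmx M)).
Proof. by rewrite -conjq_rdet conjqK. Qed.

Lemma prod_tperm_split M s i k : k \notin porbit s i -> i != k ->
  other_wt M (s * tperm i k)%g i =
  \prod_(x | [&& x \notin porbit s i, x \notin porbit s k & least s x]) wt M s x.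
Proof.
move=> ki ik; set u := (s * _)%g.
have ui x : (x \notin porbit u i) = (x \notin porbit s i) && (x \notin porbit s k).
  by rewrite -!mem_orbit_porbit orbit_merge // mem_cat negb_or.
have us x y : x \notin porbit s i -> x \notin porbit s k -> y \in porbit s x ->
    u y = s y.
  move=> xi xk yx; rewrite permM tpermD //.
    apply: contraNneq xi => ->.
    by rewrite porbit_step (porbit_eq yx) porbit_id.
  apply: contraNneq xk => ->.
  by rewrite porbit_step (porbit_eq yx) porbit_id.
have E x : x \notin porbit s i -> x \notin porbit s k -> porbit u x = porbit s x.
  by move=> xi xk; apply: eq_porbit => y; apply: us.
apply: eq_big => [x|x].
  rewrite ui -andbA; case: (boolP (x \in _)) => //= xi.
  by case: (boolP (x \in _)) => //= xk; rewrite /least E.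
rewrite ui => /andP[/andP[xi xk] _]; rewrite /wt (eq_cycle_prod (M := M) (s := s)) //.
by move=> y; apply: us.
Qed.

(** In the merged cycle the predecessor of [i] goes to [k] and gives an entry of column [k]; the
    predecessor of [k] goes to [i] and gives an entry of [c]. *)
Lemma cycle_prod_merge c M s i k : k \notin porbit s i -> i != k ->
  cycle_prod (setcol i c M) (s * tperm i k)%g i =
  cycle_prod (setcol i (col k M) M) s i * cycle_prod (setcol k c M) s k.
Proof.
move=> ki ik; rewrite /cycle_prod orbit_merge // big_cat /=; congr (_ * _).
  rewrite big_seq [RHS]big_seq; apply: eq_bigr => y.
  rewrite mem_orbit_porbit !mxE permM => yi; have [->|si] := eqVneq (s y) i.
    by rewrite tpermL eq_sym (negPf ik).
  have sk : s y != k by apply: contraNneq ki => <-; rewrite mem_porbit_step.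
  by rewrite tpermD ?(negPf si) // eq_sym.
rewrite big_seq [RHS]big_seq; apply: eq_bigr => y.
rewrite mem_orbit_porbit !mxE permM => yk; have [->|sk] := eqVneq (s y) k.
  by rewrite tpermR ?eqxx.
have si : s y != i.
  by apply: contraNneq ki => <-; rewrite porbit_step (porbit_eq yk) porbit_id.
by rewrite tpermD ?(negPf si) // eq_sym.
Qed.

(* Multiplication by [tperm i k] merges the cycles of [i] and [k], or splits
   their common cycle; all the permutations with [i] and [k] in the same cycle
   are obtained in this way from those that separate [i] and [k]. *)
Lemma cdet_setcol_split M i k c : ctrmx M = M -> i != k ->
  cdet i (setcol i c M) =
  \sum_(s : 'S_n | k \notin porbit s i)
     realq (sgn s * other_wt M s i) * cycle_prod (setcol i c M) s i -
  \sum_(s : 'S_n | k \notin porbit s i)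
     realq (sgn s * \prod_(x | [&& x \notin porbit s i, x \notin porbit s k
                                 & least s x]) wt M s x) *
     (cycle_prod (setcol i (col k M) M) s i * cycle_prod (setcol k c M) s k).
Proof.
move=> hM ik; rewrite cdet_setcol // (bigID (fun s => k \notin porbit s i)) /=.
congr (_ + _); rewrite (reindex_inj (mulIg (tperm i k))) /= -sumrN.
apply: eq_big => s; first by rewrite negbK mem_porbit_mul_tperm.
rewrite negbK mem_porbit_mul_tperm // => ki.
rewrite cycle_prod_merge // prod_tperm_split // -mulNr -rmorphN -mulNr.
by rewrite /sgn odd_permM odd_tperm ik signr_addb expr1 mulrN1.
Qed.

(** For [c = col k M], the product along the cycle of [k] in the second sum of [cdet_setcol_split]
    is taken in [M] itself and averages to [wt M s k]. This completes the remaining weights to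
    [other_wt M s i], and the two sums cancel. *)
Lemma cdet_repeated_col M i k : ctrmx M = M -> i != k ->
  cdet i (setcol i (col k M) M) = 0.
Proof.
move=> hM ik; rewrite (cdet_setcol_split _ hM ik) setcol_col; apply/eqP.
rewrite subr_eq0; apply/eqP; rewrite [RHS]sum_revc //.
- apply: eq_bigr => s ki; congr (realq _ * _); rewrite -mulrA; congr (_ * _).
  rewrite /other_wt (prod_least_split M (k := k)) 1?mulrC // => x xk.
  by apply: contra ki => xi; rewrite -(porbit_eq xi) porbit_sym.
- by move=> s; rewrite porbit_revc.
- move=> s _; rewrite sgn_revc; congr (_ * _); apply: eq_big => [x|x].
    by rewrite !porbit_revc least_revc.
  by rewrite !porbit_revc /wt => /and3P[_ xk _]; rewrite cycle_prod_revc_out.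
by move=> s ki; rewrite cycle_prod_revc_out // porbit_sym.
Qed.

(** Deletes the index [k] without changing the size: row and column [k] become those of the
    identity. *)
Definition redmx k M : 'M[quat R]_n :=
  \matrix_(x, y) if (x == k) || (y == k) then (x == y)%:R else M x y.

Lemma redmx_herm k M : ctrmx M = M -> ctrmx (redmx k M) = redmx k M.
Proof.
move=> hM; apply/matrixP=> x y; rewrite ctrmxE !mxE (orbC (y == k)) (eq_sym y x).
case: ifP => _; last by rewrite -herm_entry.
by case: (x == y); rewrite ?conjq1 ?raddf0.
Qed.

Lemma cycle_prod_setcol_eq0 c M s i :
  c ((s^-1)%g i) 0 = 0 -> cycle_prod (setcol i c M) s i = 0.
Proof.
move=> c0; apply: (cycle_prod_eq0 (y := (s^-1)%g i)).
  by rewrite mem_porbitV porbit_id.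
by rewrite permKV mxE eqxx.
Qed.

Lemma wt_redmx k M s x : x \notin porbit s k -> wt (redmx k M) s x = wt M s x.
Proof.
move=> xk; rewrite /wt (eq_cycle_prod (M := M) (s := s)) // => y yx.
have nk z : z \in porbit s x -> z != k.
  by move=> zx; apply: contraNneq xk => <-; rewrite porbit_sym.
by rewrite mxE !(negPf (nk _ _)) ?mem_porbit_step.
Qed.

(** Both sides reduce to the permutations that fix [k]. On the left, the first sum of
    [cdet_setcol_split] vanishes because the predecessor of [i] is not [k], and the unit column
    forces [s k = k] in the second. *)
Lemma cdet_delta_offdiag M i k : ctrmx M = M -> i != k ->
  cdet i (setcol i (delta_mx k 0) M) =
  - cdet i (setcol i (\col_y if y == k then 0 else M y k) (redmx k M)).
Proof.
move=> hM ik; rewrite (cdet_setcol_split _ hM ik) big1 ?sub0r => [|s ki]; last first.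
  rewrite cycle_prod_setcol_eq0 ?mulr0 // mxE andbT; case: eqP => // e.
  by case/negP: ki; rewrite -e mem_porbitV porbit_id.
congr (- _); rewrite cdet_setcol; last exact: redmx_herm.
have fixk s : s k = k -> k \notin porbit s i.
  move=> sk; rewrite porbit_sym; apply: contra ik => /porbitP[m ->].
  by apply/eqP; elim: m => [|m IHm]; rewrite ?expg0 ?perm1 // expgSr permM IHm.
rewrite (bigID (fun s : 'S_n => s k == k)) /= addrC big1 ?add0r; last first.
  move=> s /andP[ki sk]; rewrite [X in _ * (_ * X)]cycle_prod_setcol_eq0 ?mulr0 //.
  rewrite mxE andbT; case: eqP => // e; case/eqP: sk.
  by rewrite -{1}e permKV.
rewrite [RHS](bigID (fun s : 'S_n => s k == k)) /= [X in _ = _ + X]big1 ?addr0.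
  apply: eq_big => s; first by case: eqP => [/fixk->|]; rewrite ?andbF.
  case/andP=> ki /eqP sk.
  rewrite [X in _ * (_ * X)]cycle_prod_fixed // !mxE !eqxx mulr1.
  have pk x : x \in porbit s k -> x = k.
    move=> /porbitP[m ->].
    by elim: m => [|m IHm]; rewrite ?expg0 ?perm1 // expgSr permM IHm.
  congr (realq (_ * _) * _).
    rewrite /other_wt (prod_least_split _ (k := k)) => [|x /pk-> //].
    have -> : wt (redmx k M) s k = 1 by rewrite /wt cycle_prod_fixed // !mxE !eqxx.
    by rewrite mul1r; apply: eq_bigr => x /and3P[_ xk _]; rewrite wt_redmx.
  apply: eq_cycle_prod => // y yi; rewrite !mxE.
  have nk z : z \in porbit s i -> z != k by apply: contraTneq => ->.
  by rewrite !(negPf (nk _ _)) ?mem_porbit_step.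
(* Here [s] moves [k], and [redmx k M] has a zero on the cycle of [k]: in column [k] if [i] lies on
   that cycle, in row [k] otherwise. *)
move=> s sk; have [ki|ki] := boolP (k \in porbit s i).
  rewrite (cycle_prod_eq0 (y := (s^-1)%g k)) ?mulr0 ?mem_porbitV //.
  rewrite permKV !mxE eq_sym (negPf ik) eqxx orbT; case: eqP => // e.
  by case/eqP: sk; rewrite -{1}e permKV.
rewrite /other_wt (prod_least_split _ (k := k)) => [|x xk]; last first.
  by apply: contra ki => xi; rewrite -(porbit_eq xi) porbit_sym.
have -> : wt (redmx k M) s k = 0.
  by rewrite /wt (cycle_prod_eq0 (porbit_id s k)) // mxE eqxx /= eq_sym (negPf sk).
by rewrite mul0r mulr0 rmorph0 mul0r.
Qed.

Lemma cdet_delta_diag M i : ctrmx M = M ->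
  cdet i (setcol i (delta_mx i 0) M) = cdet i (redmx i M).
Proof.
move=> hM; rewrite -[redmx i M in RHS](setcol_col _ i) !cdet_setcol //;
  last exact: redmx_herm.
have -> : col i (redmx i M) = delta_mx i 0.
  by apply/matrixP=> y z; rewrite !mxE eqxx orbT ord1 andbT.
apply: eq_bigr => s _; have [si|si] := eqVneq (s i) i.
  rewrite !cycle_prod_fixed // !mxE !eqxx; congr (realq (_ * _) * _).
  by apply: eq_bigr => x /andP[xi _]; rewrite wt_redmx.
rewrite !cycle_prod_setcol_eq0 ?mulr0 // mxE andbT; case: eqP => // e;
  by case/eqP: si; rewrite -{1}e permKV.
Qed.

Definition adjq M : 'M[quat R]_n :=
  \matrix_(i, k) cdet i (setcol i (delta_mx k 0) M).

(** The replaced column enters through the last factor of the cycle opened by [i], which is itself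
    the last cycle in [cdet]. Hence the column determinant is linear in [c] with coefficients on the
    left. *)
Lemma cycle_prod_setcol c M s i : cycle_prod (setcol i c M) s i =
  (\prod_(j < #|porbit s i|.-1) M ((s ^+ j)%g i) ((s ^+ j.+1)%g i)) *
  c ((s^-1)%g i) 0.
Proof.
rewrite cycle_prodE; have := iter_porbit s i; have := uniq_traject_porbit s i.
case: #|porbit s i| (card_porbit_neq0 s i) => // N _ un sN.
have sN1 : (s ^+ N)%g i = (s^-1)%g i.
  by apply: (canRL (permK s)); rewrite permX -iterS.
rewrite big_ord_recr /= sN1 mxE permX sN eqxx; congr (_ * _).
apply: eq_bigr => j _; rewrite mxE ifN // permX.
move: un => /= /andP[+ _]; apply: contraNneq => e.
by apply/trajectP; exists j => //; rewrite -iterSr; apply: esym.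
Qed.

Lemma cdet_adjq M i c : ctrmx M = M ->
  cdet i (setcol i c M) = (adjq M *m c) i 0.
Proof.
move=> hM; rewrite mxE (eq_bigr (fun k => \sum_s realq (sgn s * other_wt M s i) *
  cycle_prod (setcol i (delta_mx k 0) M) s i * c k 0)); last first.
  by move=> k _; rewrite mxE cdet_setcol // mulr_suml.
rewrite cdet_setcol // exchange_big; apply: eq_bigr => s _ /=.
rewrite (bigD1 ((s^-1)%g i)) //= big1 => [|k ks].
  by rewrite !cycle_prod_setcol mxE !eqxx mulr1 addr0 mulrA.
rewrite cycle_prod_setcol_eq0 ?mulr0 ?mul0r // mxE andbT.
by rewrite eq_sym (negPf ks).
Qed.

Lemma mul_adjq M : ctrmx M = M -> adjq M *m M = (realq (hermdet M))%:M.
Proof.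
move=> hM; apply/matrixP=> i k; rewrite mxE.
transitivity (cdet i (setcol i (col k M) M)).
  by rewrite cdet_adjq // mxE; apply: eq_bigr => l _; rewrite !mxE.
have [<-|ik] := eqVneq i k; rewrite mxE.
  by rewrite setcol_col (cdet_herm _ hM) eqxx mulr1n.
by rewrite cdet_repeated_col // (negPf ik) mulr0n.
Qed.

End HermitianDeterminant.

Lemma hdet_hermdet (R : realFieldType) n (M : 'M[quat R]_n) :
  ctrmx M = M -> hdet M = realq (hermdet M).
Proof.
case: n M => [|n] M hM /=; last first.
  by rewrite rdet_conj hM (cdet_herm _ hM) conjq_realq.
(* In size 0, [hdet] is 1 by convention, and the identity is the only permutation. *)
rewrite /hermdet (bigD1 1%g) //= [X in _ + X]big1 ?addr0 => [|s].
  by rewrite /sgn odd_perm1 expr0 mul1r big1 ?rmorph1 // => -[].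
by case/eqP; apply/permP=> -[].
Qed.

(** * Principal submatrices, padded by the identity to full size *)

Section PrincipalSubmatrices.
Variables (S : nzRingType) (n : nat).

(** Padding gives the submatrices on all sets [b] the same type, so that their adjugates can be
    added. *)
Definition padmx (b : {set 'I_n}) (M : 'M[S]_n) : 'M[S]_n :=
  \matrix_(x, y) if (x \in b) && (y \in b) then M x y else (x == y)%:R.

Variable b : {set 'I_n}.
Let f : 'I_#|b| -> 'I_n := @enum_val _ (mem b).
Implicit Types (M : 'M[S]_n) (t : 'S_#|b|) (s : 'S_n).

Variables (i : 'I_n) (ib : i \in b).
Let rk : 'I_n -> 'I_#|b| := enum_rank_in ib.

Let fb y : f y \in b. Proof. exact: enum_valP. Qed.
Let fK : cancel f rk. Proof. exact: enum_valK_in. Qed.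
Let rkK x : x \in b -> f (rk x) = x. Proof. by move=> xb; apply: enum_rankK_in. Qed.

Let ext_fun t x := if x \in b then f (t (rk x)) else x.

Let ext_fun_inj t : injective (ext_fun t).
Proof.
move=> x y; rewrite /ext_fun; case: ifPn => xb; case: ifPn => yb.
- by move/(can_inj fK)/perm_inj/(congr1 f); rewrite !rkK.
- by move=> e; rewrite -e fb in yb.
- by move=> e; rewrite e fb in xb.
- by [].
Qed.

Let ext t : 'S_n := perm (@ext_fun_inj t).

Let extf t y : ext t (f y) = f (t y).
Proof. by rewrite permE /ext_fun fb fK. Qed.

Let ext_out t x : x \notin b -> ext t x = x.
Proof. by move=> xb; rewrite permE /ext_fun (negPf xb). Qed.

Let ext_inj : injective ext.
Proof.
move=> t u e; apply/permP=> y; apply: (can_inj fK).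
by rewrite -!extf e.
Qed.

Let ext_onto : ext @: [set: 'S_#|b|] = [set s | perm_on b s].
Proof.
apply/eqP; rewrite eqEcard; apply/andP; split.
  apply/subsetP=> _ /imsetP[t _ ->]; rewrite inE; apply/subsetP=> x.
  by rewrite inE; apply: contraNT => /ext_out->.
rewrite card_imset // cardsT cardsE card_perm.
by rewrite card_Sn.
Qed.

Let extX t k y : (ext t ^+ k)%g (f y) = f ((t ^+ k)%g y).
Proof.
by elim: k => [|k IHk]; rewrite ?expg0 ?perm1 // !expgSr !permM IHk extf.
Qed.

Let porbit_ext t y : porbit (ext t) (f y) = f @: porbit t y.
Proof.
apply/setP=> x; apply/porbitP/imsetP => [[k ->]|[z /porbitP[k ->] ->]].
  by exists ((t ^+ k)%g y); rewrite ?mem_porbit // extX.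
by exists k; rewrite extX.
Qed.

Let f_inj : injective f := can_inj fK.

Let mem_porbit_ext t y z : (f z \in porbit (ext t) (f y)) = (z \in porbit t y).
Proof. by rewrite porbit_ext mem_imset. Qed.

Let enumb : enum b = [seq x <- enum 'I_n | x \in b].
Proof. by rewrite enumT. Qed.

(** Relabelling by [enum_val] must preserve the least elements of cycles; this is where its
    increasing order counts. *)
Let leq_f y z : (f y <= f z)%N = (y <= z)%N.
Proof.
pose vals := map val (enum b).
have srt : sorted ltn vals.
  rewrite /vals enumb; apply: (subseq_sorted ltn_trans (s2 := iota 0 n)).
    by rewrite -val_enum_ord; apply: map_subseq; apply: filter_subseq.
  exact: iota_ltn_sorted.
have szv : size vals = #|b| by rewrite size_map cardE.
have nthv (x : 'I_#|b|) : nth 0%N vals x = f x.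
  rewrite /vals (nth_map i) -?cardE //; congr val.
  by rewrite /f (enum_val_nth i).
have := sorted_ltn_nth ltn_trans 0%N srt; rewrite -/vals => mono.
rewrite -!nthv; apply: (leq_mono_in mono); rewrite inE szv ltn_ord //.
Qed.

Let least_ext t y : least (ext t) (f y) = least t y.
Proof.
apply/forall_inP/forall_inP => h z zy.
  by rewrite -leq_f h // mem_porbit_ext.
by move: zy; rewrite porbit_ext => /imsetP[w wy ->]; rewrite leq_f h.
Qed.

Let cycle_prod_ext M t y :
  cycle_prod (padmx b M) (ext t) (f y) = cycle_prod (psubmx b M) t y.
Proof.
rewrite !cycle_prodE porbit_ext card_imset //; apply: eq_bigr => j _.
by rewrite !extX !mxE !fb.
Qed.

Let enum_map : enum b = map f (enum 'I_#|b|).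
Proof.
apply: (@eq_from_nth _ i) => [|j]; first by rewrite size_map size_enum_ord cardE.
rewrite -cardE => jb; rewrite (nth_map (rk i)) ?size_enum_ord //.
rewrite /f (enum_val_nth i); congr (nth _ _ _).
by rewrite nth_enum_ord.
Qed.

Let heads_ext t :
  [seq x <- cycle_heads (ext t) i | x \in b] = map f (cycle_heads t (rk i)).
Proof.
rewrite /cycle_heads /= ib rkK //; congr (_ :: _).
rewrite -filter_predI (eq_filter (a2 := predI
   (fun x => (x \notin porbit (ext t) i) && least (ext t) x) (mem b))); last first.
  by move=> x /=; rewrite andbC.
rewrite filter_predI -enumb enum_map filter_map.
congr (map f _); apply: eq_filter => y /=.
by rewrite least_ext -{1}(rkK ib) mem_porbit_ext.
Qed.

Let ext1 : ext 1 = 1%g.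
Proof.
apply/permP=> x; rewrite perm1; have [xb|xb] := boolP (x \in b).
  by rewrite -(rkK xb) extf perm1.
exact: ext_out.
Qed.

Let ext_tperm x y t : ext (tperm x y * t)%g = (tperm (f x) (f y) * ext t)%g.
Proof.
apply/permP=> z; rewrite permM; have [zb|zb] := boolP (z \in b).
  rewrite -(rkK zb) extf permM; set w := rk z.
  by case: (tpermP x y w) => [->|->|/eqP wx /eqP wy];
    rewrite ?tpermL ?tpermR ?tpermD ?extf // eq_sym (inj_eq f_inj).
rewrite ext_out // tpermD ?ext_out //; apply: contraNneq zb => <-; exact: fb.
Qed.

Let odd_ext t : odd_perm (ext t) = odd_perm t.
Proof.
have [ts -> _] := prod_tpermP t; elim: ts => [|[x y] ts IHts].
  by rewrite big_nil ext1 !odd_perm1.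
by rewrite big_cons ext_tperm !odd_mul_tperm IHts (inj_eq f_inj).
Qed.

Let cycle_heads_cover s y : exists2 x, x \in cycle_heads s i & y \in porbit s x.
Proof.
have [yi|yi] := boolP (y \in porbit s i); first by exists i; rewrite ?mem_head.
have [x xy lx] := least_exists s y; exists x; last by rewrite porbit_sym.
rewrite inE mem_filter mem_enum andbT [X in _ && X]lx andbT orbC.
rewrite (contra _ yi) // => xi.
by rewrite -(porbit_eq xi) porbit_sym.
Qed.

(** A permutation that moves a point outside [b] meets an off-diagonal zero of the padding. The
    others extend permutations of [b] by fixed points, each of which contributes a factor 1. *)
Lemma cdet_subE M : cdet_sub b i M = cdet i (padmx b M).
Proof.
rewrite /cdet_sub; case: {-}_ / idP => // ib'.
rewrite (bool_irrelevance ib' ib) {ib'} -/rk.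
rewrite /cdet [RHS](bigID (perm_on b)) /= [X in _ = _ + X]big1 ?addr0.
  rewrite (eq_bigl (fun s => s \in ext @: [set: 'S_#|b|])) => [|s]; last first.
    by rewrite ext_onto inE.
  rewrite big_imset /=; last by move=> t u _ _ /ext_inj.
  rewrite (eq_bigl xpredT) => [|t]; last by rewrite inE.
  apply: eq_bigr => t _; rewrite !sign_porbits odd_ext; congr (_ * _).
  transitivity (\prod_(x <- rev (cycle_heads (ext t) i) | x \in b)
                  cycle_prod (padmx b M) (ext t) x).
    rewrite -[RHS]big_filter filter_rev heads_ext -map_rev big_map.
    by apply: eq_bigr => y _; rewrite cycle_prod_ext.
  rewrite big_mkcond; apply: eq_bigr => x _; case: ifPn => // xb.
  by rewrite cycle_prod_fixed ?ext_out // mxE (negPf xb) eqxx.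
move=> s /subsetPn[y]; rewrite inE => sy yb.
have [x xs yx] := cycle_heads_cover s y.
rewrite (prod_seq_eq0 (z := x)) ?mulr0 ?mem_rev //.
by rewrite (cycle_prod_eq0 yx) // mxE (negPf yb) eq_sym (negPf sy).
Qed.

End PrincipalSubmatrices.

(** * The Faddeev-LeVerrier recursion for sums of principal adjugates *)

Section PaddedHermitian.
Variables (R : realFieldType) (n : nat).
Implicit Types (b : {set 'I_n}) (M : 'M[quat R]_n) (i k : 'I_n).

Lemma padmx_herm b M : ctrmx M = M -> ctrmx (padmx b M) = padmx b M.
Proof.
move=> hM; apply/matrixP=> x y; rewrite ctrmxE !mxE andbC (eq_sym y x).
case: ifP => _; first by rewrite -herm_entry.
by case: (x == y); rewrite ?conjq1 ?raddf0.
Qed.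

Lemma psubmx_herm b M : ctrmx M = M -> ctrmx (psubmx b M) = psubmx b M.
Proof. by move=> hM; apply/matrixP=> x y; rewrite ctrmxE !mxE -herm_entry. Qed.

Lemma hdet_psubmx b M i : ctrmx M = M -> i \in b ->
  hdet (psubmx b M) = realq (hermdet (padmx b M)).
Proof.
move=> hM ib; rewrite hdet_hermdet ?psubmx_herm //.
rewrite -(cdet_herm (enum_rank_in ib i)) ?psubmx_herm //.
rewrite -(cdet_herm i) ?padmx_herm // -(cdet_subE ib) /cdet_sub.
by case: {-}_ / idP => // ib'; rewrite (bool_irrelevance ib' ib).
Qed.

Lemma padmx_setT M : padmx [set: 'I_n] M = M.
Proof. by apply/matrixP=> x y; rewrite mxE !inE. Qed.

Lemma cdet_subT M i : cdet_sub [set: 'I_n] i M = cdet i M.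
Proof. by rewrite cdet_subE ?inE // padmx_setT. Qed.

Lemma conjq_rdet_sub b M i : conjq (rdet_sub b i M) = cdet_sub b i (ctrmx M).
Proof.
rewrite /rdet_sub /cdet_sub; case: {-}_ / idP => [ib|_]; last by rewrite raddf0.
by rewrite conjq_rdet; congr cdet; apply/matrixP=> x y; rewrite !mxE.
Qed.

Lemma ctrmx_setrow M j (c : 'rV_n) :
  ctrmx (setrow j c M) = setcol j (ctrmx c) (ctrmx M).
Proof. by apply/matrixP=> x y; rewrite !mxE; case: ifP. Qed.

Definition maskcol b (c : 'cV[quat R]_n) : 'cV[quat R]_n :=
  \col_k (if k \in b then c k 0 else 0).

Lemma cdet_sub_setcol b M i c : ctrmx M = M -> i \in b ->
  cdet_sub b i (setcol i c M) = (adjq (padmx b M) *m maskcol b c) i 0.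
Proof.
move=> hM ib; rewrite (cdet_subE ib) -cdet_adjq ?padmx_herm //; congr cdet.
apply/matrixP=> x y; rewrite !mxE.
case: (eqVneq y i) => [->|yi]; rewrite ?ib ?andbT //.
by case: ifPn => // xb; case: eqP => // e; rewrite e ib in xb.
Qed.

(** Column [k] of the padded matrix is a unit column, so this entry is also the entry at [(i, k)] of
    the scalar matrix in [mul_adjq]. *)
Lemma adjq_padmx_out b M i k : ctrmx M = M -> i \in b -> k \notin b ->
  adjq (padmx b M) i k = 0.
Proof.
move=> hM ib kb; have := mul_adjq (padmx_herm b hM).
have ik : i != k by apply: contraNneq kb => <-.
move/matrixP/(_ i k); rewrite mxE [RHS]mxE (negPf ik) mulr0n => <-.
rewrite (bigD1 k) //= big1 => [|l lk].
  by rewrite [padmx _ _ _ _]mxE (negPf kb) eqxx mulr1 addr0.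
by rewrite [padmx _ _ _ _]mxE (negPf kb) andbF (negPf lk) mulr0.
Qed.

Lemma cdet_sub_adjq b M i c : ctrmx M = M -> i \in b ->
  cdet_sub b i (setcol i c M) = (adjq (padmx b M) *m c) i 0.
Proof.
move=> hM ib; rewrite cdet_sub_setcol // !mxE; apply: eq_bigr => k _.
rewrite [maskcol _ _ _ _]mxE; case: ifPn => // kb.
by rewrite adjq_padmx_out ?mul0r ?mulr0.
Qed.

(* [R_r] in the Faddeev-LeVerrier recursion
   [R_1 = 1], [R_(r+1) = d_r - R_r M], where [d_r] is the sum of the principal
   minors of order [r]. *)
Definition adjsum r M : 'M[quat R]_n :=
  \matrix_(i, k) \sum_(b in idx_at r i) adjq (padmx b M) i k.

Definition minorsum r M : R := \sum_(b in idx r n) hermdet (padmx b M).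

Lemma sum_hdet r M : (0 < r)%N -> ctrmx M = M ->
  \sum_(b in idx r n) hdet (psubmx b M) = realq (minorsum r M).
Proof.
move=> r0 hM; rewrite rmorph_sum; apply: eq_bigr => b.
rewrite inE => /eqP br; have [i ib] : exists i, i \in b.
  by apply/set0Pn; rewrite -card_gt0 br.
exact: (hdet_psubmx hM ib).
Qed.

Lemma sum_cdet_sub r M i c : ctrmx M = M ->
  \sum_(b in idx_at r i) cdet_sub b i (setcol i c M) = (adjsum r M *m c) i 0.
Proof.
move=> hM; rewrite mxE.
rewrite (eq_bigr (fun b => \sum_k adjq (padmx b M) i k * c k 0)) => [|b].
  by rewrite exchange_big; apply: eq_bigr => k _; rewrite mxE mulr_suml.
by rewrite inE => /andP[_ ib]; rewrite cdet_sub_adjq // mxE.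
Qed.

Lemma redmx_padmx b M k : k \notin b ->
  redmx k (padmx (k |: b) M) = padmx b M.
Proof.
move=> kb; apply/matrixP=> x y; rewrite !mxE !inE.
have [->|xk] := eqVneq x k; first by rewrite (negPf kb).
by have [->|yk] := eqVneq y k; rewrite /= ?(negPf kb) ?andbF.
Qed.

Lemma sum_idx_setU1 (V : zmodType) r k (P : pred {set 'I_n}) (F : {set 'I_n} -> V) :
  \sum_(b : {set 'I_n} | [&& #|b| == r.+1, k \in b & P b]) F b =
  \sum_(b : {set 'I_n} | [&& #|b| == r, k \notin b & P (k |: b)]) F (k |: b).
Proof.
rewrite (reindex_onto (fun b => k |: b) (fun b => b :\ k)) => [|b /and3P[_ kb _]].
  apply: eq_bigl => b; rewrite setU11 cardsU1.
  have [kb|kb] := boolP (k \in b); last by rewrite setU1K // eqxx andbT.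
  rewrite andbF; apply/negP=> /andP[_ /eqP/setP/(_ k)].
  by rewrite !inE eqxx kb.
exact: setD1K.
Qed.

Lemma adjsum_rec r M : (0 < r)%N -> ctrmx M = M ->
  adjsum r.+1 M + adjsum r M *m M = (realq (minorsum r M))%:M.
Proof.
move=> r0 hM; apply/matrixP=> i k.
have E : (adjsum r M *m M) i k =
    \sum_(b in idx_at r i) (adjq (padmx b M) *m maskcol b (col k M)) i 0.
  transitivity ((adjsum r M *m col k M) i 0).
    by rewrite !mxE; apply: eq_bigr => l _; rewrite !mxE.
  rewrite -sum_cdet_sub //; apply: eq_bigr => b; rewrite inE => /andP[_ ib].
  exact: cdet_sub_setcol.
have hP b := padmx_herm b hM.
rewrite mxE E [adjsum _ _ _ _]mxE [RHS]mxE.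
have colE b : k \in b -> maskcol b (col k M) = col k (padmx b M).
  move=> kb; apply/matrixP=> x y; rewrite !mxE kb andbT.
  by case: ifPn => // xb; case: eqP => // e; rewrite e kb in xb.
have in_b b : k \in b -> (adjq (padmx b M) *m maskcol b (col k M)) i 0 =
    realq (hermdet (padmx b M)) *+ (i == k).
  move=> kb; rewrite colE //; have /matrixP/(_ i k) := mul_adjq (hP b).
  rewrite [RHS]mxE => <-; rewrite [LHS]mxE [RHS]mxE.
  by apply: eq_bigr => l _; rewrite [col _ _ _ _]mxE.
(* On the diagonal, [mul_adjq] yields the minors on the sets of order [r] that contain [i]. Those on
   the sets without [i] come from the sets [i |: b] of order [r.+1], by [cdet_delta_diag]. *)
have [eik|ik] := eqVneq i k.
  rewrite mulr1n /minorsum rmorph_sum /= [RHS](bigID (fun b => i \in b)) /= addrC.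
  congr (_ + _).
    apply: eq_big => [b|b]; first by rewrite !inE.
    by rewrite inE => /andP[_ ib]; rewrite in_b -eik ?eqxx.
  transitivity (\sum_(b : {set 'I_n} | [&& #|b| == r.+1, i \in b & true])
                   adjq (padmx b M) i i).
    by rewrite -eik; apply: eq_bigl => b; rewrite inE andbT.
  rewrite sum_idx_setU1; apply: eq_big => [b|b]; first by rewrite inE andbT.
  case/and3P=> _ ib _; rewrite mxE cdet_delta_diag //.
  by rewrite redmx_padmx // (cdet_herm _ (hP b)).
(* Off the diagonal, the sets of order [r.+1] without [k] and those of order [r] with [k] contribute
   0. The remaining terms for [b] and [k |: b] cancel by [cdet_delta_offdiag]. *)
rewrite mulr0n [X in X + _](bigID (fun b => k \in b)) /=.
rewrite [X in _ + X + _]big1 ?addr0; last first.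
  by move=> b; rewrite inE -andbA => /and3P[_ ib kb]; rewrite adjq_padmx_out.
rewrite [X in _ + X](bigID (fun b => k \in b)) /= [X in _ + (X + _)]big1.
  rewrite add0r.
  transitivity (\sum_(b : {set 'I_n} | [&& #|b| == r.+1, k \in b & i \in b])
                   adjq (padmx b M) i k +
      \sum_(b : {set 'I_n} | [&& #|b| == r, k \notin b & i \in k |: b])
          (adjq (padmx b M) *m maskcol b (col k M)) i 0).
    congr (_ + _); apply: eq_bigl => b.
      by rewrite inE -andbA; congr (_ && _); rewrite andbC.
    rewrite !inE (negPf ik) -andbA; congr (_ && _); exact: andbC.
  rewrite sum_idx_setU1 -big_split big1 // => b /and3P[_ kb]; rewrite /= inE in_set1.
  rewrite (negPf ik) /= => ib; rewrite {1}mxE cdet_delta_offdiag // redmx_padmx //.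
  rewrite cdet_adjq // (_ : (\col_y _) = maskcol b (col k M)) ?addNr //.
  apply/matrixP=> y z; rewrite !mxE !inE eqxx /=.
  have [->|yk] := eqVneq y k; first by rewrite (negPf kb).
  by rewrite /= andbT.
by move=> b; rewrite inE -andbA => /and3P[_ ib kb]; rewrite in_b // (negPf ik) mulr0n.
Qed.

End PaddedHermitian.

(** * Gram matrices, the squared Frobenius norm, and kernels of wide matrices *)

Section ConjugateTranspose.
Variable R : realFieldType.
Local Notation H := (quat R).

Lemma ctrmx_mul m n p (A : 'M[H]_(m, n)) (B : 'M[H]_(n, p)) :
  ctrmx (A *m B) = ctrmx B *m ctrmx A.
Proof.
apply/matrixP=> x y; rewrite ctrmxE !mxE raddf_sum; apply: eq_bigr => j _ /=.
by rewrite conjqM !ctrmxE.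
Qed.

Lemma ctrmx_is_zmod_morphism m n : zmod_morphism (@ctrmx R m n).
Proof. by move=> A B; apply/matrixP=> x y; rewrite !mxE raddfB. Qed.
HB.instance Definition _ m n := GRing.isZmodMorphism.Build
  'M[H]_(m, n) 'M[H]_(n, m) (@ctrmx R m n) (@ctrmx_is_zmod_morphism m n).

Lemma scale_realqAr m n p a (A : 'M[H]_(m, n)) (B : 'M[H]_(n, p)) :
  A *m (realq a *: B) = realq a *: (A *m B).
Proof.
apply/matrixP=> x y; rewrite !mxE mulr_sumr; apply: eq_bigr => j _.
by rewrite !mxE !mulrA realqC.
Qed.

Lemma ctrmx_realq m n a (A : 'M[H]_(m, n)) :
  ctrmx (realq a *: A) = realq a *: ctrmx A.
Proof. by apply/matrixP=> x y; rewrite !mxE conjqM conjq_realq realqC. Qed.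

Lemma ctrmx1 n : ctrmx 1%:M = 1%:M :> 'M[H]_n.
Proof.
apply/matrixP=> i j; rewrite ctrmxE !mxE eq_sym.
by case: (i == j); rewrite ?conjq1 ?raddf0.
Qed.

Lemma scale_realq_inj m n a : a != 0 ->
  injective (fun A : 'M[H]_(m, n) => realq a *: A).
Proof.
move=> a0 A B /(congr1 (fun C => realq a^-1 *: C)).
by rewrite !scalerA -rmorphM mulVf // rmorph1 !scale1r.
Qed.

Definition sqn m n (A : 'M[H]_(m, n)) : R := \sum_i \sum_j sqnormq (A i j).

Lemma sqnormq_ge0 (x : H) : 0 <= sqnormq x.
Proof. by rewrite /sqnormq !addr_ge0 ?sqr_ge0. Qed.

Lemma sqn_ge0 m n (A : 'M[H]_(m, n)) : 0 <= sqn A.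
Proof. by apply: sumr_ge0 => i _; apply: sumr_ge0 => j _; apply: sqnormq_ge0. Qed.

Lemma sqn_eq0 m n (A : 'M[H]_(m, n)) : sqn A = 0 -> A = 0.
Proof.
move=> /psumr_eq0P A0; apply/matrixP=> i j; rewrite mxE; apply/eqP.
rewrite -sqnormq_eq0; apply/eqP.
have /psumr_eq0P : \sum_j sqnormq (A i j) = 0.
  by apply: A0 => // k _; apply: sumr_ge0 => l _; apply: sqnormq_ge0.
by apply=> // l _; apply: sqnormq_ge0.
Qed.

Lemma sqn_gt0 m n (A : 'M[H]_(m, n)) : A != 0 -> 0 < sqn A.
Proof. by rewrite lt0r sqn_ge0 andbT; apply: contra_neq; apply: sqn_eq0. Qed.

Lemma mul_ctrmx_eq0 m n (A : 'M[H]_(m, n)) : A *m ctrmx A = 0 -> A = 0.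
Proof.
move=> A0; apply: sqn_eq0; apply: big1 => i _; apply: (@realq_inj R).
move/matrixP/(_ i i): A0; rewrite !mxE rmorph_sum rmorph0 => A0.
rewrite -[RHS]A0; apply: eq_bigr => j _.
by rewrite ctrmxE mulq_conj.
Qed.

Lemma mul_gram_eq0 m n p (A : 'M[H]_(m, n)) (X : 'M[H]_(p, n)) :
  X *m (ctrmx A *m A) = 0 -> X *m ctrmx A = 0.
Proof.
move=> X0; apply: mul_ctrmx_eq0.
by rewrite ctrmx_mul ctrmxK !mulmxA -(mulmxA X) X0 mul0mx.
Qed.

Lemma gram_herm m n (A : 'M[H]_(m, n)) : ctrmx (ctrmx A *m A) = ctrmx A *m A.
Proof. by rewrite ctrmx_mul ctrmxK. Qed.

Lemma mul_gram2_eq0 m n p (A : 'M[H]_(m, n)) (X : 'M[H]_(p, n)) :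
  X *m (ctrmx A *m A) *m (ctrmx A *m A) = 0 -> X *m (ctrmx A *m A) = 0.
Proof.
set G := ctrmx A *m A => X0; apply: mul_ctrmx_eq0.
by rewrite ctrmx_mul gram_herm mulmxA X0 mul0mx.
Qed.

Lemma unitqE (x : H) : (x \is a GRing.unit) = (x != 0).
Proof. by []. Qed.

(** Solves [c *m x = 0] for one coordinate [j]; the columns of [N] parametrize the solutions by the
    other coordinates. *)
Lemma row_annihilator n (c : 'rV[H]_n.+1) : exists N : 'M[H]_(n.+1, n),
  c *m N = 0 /\ forall y : 'cV_n, N *m y = 0 -> y = 0.
Proof.
(* The pivot: [c 0 j] is nonzero unless [c = 0], in which case any index serves. *)
have [j cj] : exists j, c 0 j = 0 -> c = 0.
  have [->|/rV0Pn[j cj]] := eqVneq c 0; first by exists ord0.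
  by exists j => c0; rewrite c0 eqxx in cj.
exists (\matrix_(i, l) if unlift j i is Some i' then (i' == l)%:R
                       else - ((c 0 j)^-1 * c 0 (lift j l))); split.
  apply/matrixP=> x l; rewrite !mxE (bigD1_ord j) //= mxE unlift_none ord1.
  rewrite (bigD1 l) //= big1 => [|k kl]; last first.
    by rewrite mxE liftK (negPf kl) mulr0.
  rewrite mxE liftK eqxx mulr1 addr0 mulrN mulrA.
  have [c0|c0] := eqVneq (c 0 j) 0; first by rewrite (cj c0) !mxE mulr0 oppr0 addr0.
  by rewrite mulrV // mul1r addNr.
move=> y Ny; apply/matrixP=> l z; rewrite ord1 mxE.
move/matrixP/(_ (lift j l) 0): Ny; rewrite !mxE (bigD1 l) //= big1 => [|k kl].
  by rewrite mxE liftK eqxx mul1r addr0.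
by rewrite mxE liftK eq_sym (negPf kl) mul0r.
Qed.

(** Elimination: each row is solved by [row_annihilator], at the cost of one unknown. *)
Lemma wide_kernel r k (C : 'M[H]_(r, k)) : (r < k)%N ->
  exists2 x : 'cV_k, x != 0 & C *m x = 0.
Proof.
elim: r k C => [|r IHr] [|k] C // rk.
  exists (const_mx 1); last by apply/matrixP=> -[].
  by apply/eqP=> /matrixP/(_ ord0 0)/eqP; rewrite !mxE oner_eq0.
have [N [cN Ninj]] := row_annihilator (usubmx (C : 'M_(1 + r, _))).
have [y y0 Cy] := IHr k (dsubmx (C : 'M_(1 + r, _)) *m N) rk.
exists (N *m y); first by apply: contra_neq y0; apply: Ninj.
have := mul_col_mx (usubmx (C : 'M_(1 + r, _))) (dsubmx (C : 'M_(1 + r, _)))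
  (N *m y).
by rewrite vsubmxK (mulmxA (usubmx _)) cN mul0mx (mulmxA (dsubmx _)) Cy col_mx0.
Qed.

End ConjugateTranspose.

(** * Signs of the principal minors of a Gram matrix, and their relation to the rank *)

Section PrincipalMinors.
Variables (R : realFieldType) (m n : nat) (A : 'M[quat R]_(m, n)).
Local Notation H := (quat R).
Implicit Type b : {set 'I_n}.

Let G := ctrmx A *m A.
Let hG : ctrmx G = G. Proof. exact: gram_herm. Qed.
Let D b := hermdet (padmx b G).

Definition indep_cols b := forall x : 'cV[H]_n,
  (forall l, l \notin b -> x l 0 = 0) -> A *m x = 0 -> x = 0.

Lemma padmx_mul b (M : 'M[H]_n) (x : 'cV[H]_n) y :
    (forall l, l \notin b -> x l 0 = 0) -> y \in b ->
  (padmx b M *m x) y 0 = (M *m x) y 0.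
Proof.
move=> xb yb; rewrite !mxE; apply: eq_bigr => l _; rewrite mxE yb /=.
by case: ifPn => // lb; rewrite xb // !mulr0.
Qed.

(** The padded matrix kills an [x] supported on [b] with [A *m x = 0]; multiplying by the adjugate
    gives [D b] times [x]. *)
Lemma indep_cols_minor b : D b != 0 -> indep_cols b.
Proof.
move=> D0 x xb Ax; apply: (scale_realq_inj D0); rewrite scaler0.
rewrite -mul_scalar_mx -mul_adjq ?padmx_herm // -mulmxA.
rewrite (_ : padmx b G *m x = 0) ?mulmx0 //; apply/matrixP=> y z.
rewrite ord1 [RHS]mxE; have [yb|yb] := boolP (y \in b).
  by rewrite padmx_mul // -mulmxA Ax mulmx0 mxE.
rewrite mxE (bigD1 y) //= big1 => [|l ly].
  by rewrite mxE (negPf yb) eqxx mul1r addr0 xb.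
by rewrite mxE (negPf yb) eq_sym (negPf ly) mul0r.
Qed.

Lemma hermdet1 : hermdet (1%:M : 'M[H]_n) = 1.
Proof.
rewrite /hermdet (bigD1 1%g) //= [X in _ + X]big1 ?addr0 => [|s s1].
  rewrite /sgn odd_perm1 expr0 mul1r big1 // => x _.
  by rewrite /wt cycle_prod_fixed ?perm1 // mxE eqxx.
have [x sx] : exists x, s x != x.
  apply/existsP; apply: contraNT s1; rewrite negb_exists => /forallP s1.
  by apply/eqP/permP=> x; rewrite perm1; apply/eqP; have := s1 x; rewrite negbK.
have [y yx ly] := least_exists s x.
rewrite (bigD1 y) //= (wt_porbit _ yx) /wt.
rewrite (cycle_prod_eq0 (porbit_id s x)) ?mul0r ?mulr0 //.
by rewrite mxE eq_sym (negPf sx).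
Qed.

(* A row of the adjugate of the principal submatrix, as a combination of the
   columns of [A]. *)
Lemma minor_descent b i : i \in b -> exists x : 'cV[H]_n,
  [/\ forall l, l \notin b -> x l 0 = 0, x i 0 = realq (D (b :\ i)) &
      sqn (A *m x) = D b * D (b :\ i)].
Proof.
move=> ib; set P := padmx b G; have hP : ctrmx P = P by apply: padmx_herm.
have x_i : ctrmx (row i (adjq P)) i 0 = realq (D (b :\ i)).
  rewrite ctrmxE !mxE cdet_delta_diag // /P -{1}(setD1K ib) redmx_padmx ?setD11 //.
  by rewrite (cdet_herm _ (padmx_herm _ hG)) conjq_realq.
have x_out l : l \notin b -> ctrmx (row i (adjq P)) l 0 = 0.
  by move=> lb; rewrite ctrmxE mxE adjq_padmx_out // raddf0.
exists (ctrmx (row i (adjq P))); split=> //; set x := ctrmx _ in x_i x_out *.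
apply: (@realq_inj R); rewrite rmorphM /=.
transitivity ((ctrmx (A *m x) *m (A *m x)) 0 0).
  rewrite mxE rmorph_sum; apply: eq_bigr => j _.
  by rewrite big_ord1 ctrmxE mulq_conjl.
rewrite ctrmx_mul -mulmxA (mulmxA _ A) -/G.
transitivity ((ctrmx x *m (P *m x)) 0 0).
  rewrite [LHS]mxE [RHS]mxE; apply: eq_bigr => y _.
  have [yb|yb] := boolP (y \in b); first by rewrite [in RHS]padmx_mul.
  by rewrite ctrmxE (x_out _ yb) raddf0 !mul0r.
(* [ctrmx x] is row [i] of [adjq P], so its product with [P] is [D b] times a unit row, which picks
   out [x i 0]. *)
rewrite mulmxA {1}/x ctrmxK -!row_mul mxE mul_adjq // mul_scalar_mx mxE.
by rewrite x_i.
Qed.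

(** Induction on the size of [b]. The vector of [minor_descent] is nonzero because its entry at [i]
    is the smaller minor, so by independence [D b * D (b :\ i)] is positive. *)
Lemma minor_pos b : indep_cols b -> 0 < D b.
Proof.
have [k] := ubnP #|b|; elim: k b => // k IHk b; rewrite ltnS => bk indb.
have [->|/set0Pn[i ib]] := eqVneq b set0.
  rewrite /D (_ : padmx _ _ = 1%:M) ?hermdet1 //.
  by apply/matrixP=> x y; rewrite !mxE !inE.
have [x [xb xi sx]] := minor_descent ib.
have D1 : 0 < D (b :\ i).
  apply: IHk; first by rewrite (leq_trans _ bk) // [in leqRHS](cardsD1 i) ib.
  move=> z zb; apply: indb => l lb; apply: zb.
  by rewrite inE negb_and lb orbT.
rewrite -(pmulr_lgt0 _ D1) -sx sqn_gt0 //; apply/eqP => /(indb _ xb) x0.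
move: xi; rewrite x0 mxE => /esym/eqP.
by rewrite -(rmorph0 (@realq R)) (inj_eq (@realq_inj R)) gt_eqF.
Qed.

Lemma minor_ge0 b : 0 <= D b.
Proof.
by have [->|/indep_cols_minor/minor_pos/ltW] := eqVneq (D b) 0.
Qed.

(** The vector of [minor_descent] for [i |: b] is then in the kernel of [A], and its entry at [i]
    comes from [D b], so the relation can be solved for column [i]. *)
Lemma minor_eq0_dep b i : i \notin b -> D b != 0 -> D (i |: b) = 0 ->
  exists y : 'cV[H]_n, (forall l, l \notin b -> y l 0 = 0) /\ col i A = A *m y.
Proof.
move=> ib Db D0; have [x [xb xi sx]] := minor_descent (setU11 i b).
rewrite setU1K // in xi sx; rewrite D0 mul0r in sx.
have u : x i 0 \is a GRing.unit.
  rewrite unitqE xi; apply: contraNneq Db => /(congr1 (@q1 R))/= ->; exact: eqxx.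
exists (\col_l if l == i then 0 else - (x l 0 / x i 0)); split=> [l lb|].
  rewrite mxE; case: eqP => // /eqP li.
  by rewrite xb ?mul0r ?oppr0 // !inE negb_or li.
have /matrixP Ax := sqn_eq0 sx; apply/matrixP=> y z; rewrite !mxE.
move: (Ax y 0); rewrite !mxE (bigD1 i) //= => /eqP; rewrite addr_eq0 => /eqP e.
rewrite (bigD1 i) //= mxE eqxx mulr0 add0r -[LHS](mulrK u) e mulNr mulr_suml.
rewrite -sumrN; apply: eq_bigr => l li.
by rewrite mxE (negPf li) mulrN mulrA.
Qed.

Section Rank.
Variable r : nat.
Hypothesis rkA : has_rank A r.

Lemma rank_factor :
  exists (B : 'M[H]_(m, r)) (C : 'M[H]_(r, n)) (Y : 'M[H]_(n, r)),
  [/\ forall x : 'cV_r, B *m x = 0 -> x = 0, A = B *m C & B = A *m Y].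
Proof.
have [B [Binj Bim]] := rkA.
have /fin_all_exists[c Ec] j : exists x : 'cV[H]_r, col j A = B *m x.
  by apply/Bim; exists (delta_mx j 0); rewrite colE.
have /fin_all_exists[y Ey] j : exists x : 'cV[H]_n, col j B = A *m x.
  by apply/Bim; exists (delta_mx j 0); rewrite colE.
exists B, (\matrix_(k, j) c j k 0), (\matrix_(k, j) y j k 0); split=> //.
  apply/matrixP=> k j; have /matrixP/(_ k 0) := Ec j; rewrite !mxE => ->.
  by apply: eq_bigr => l _; rewrite mxE.
apply/matrixP=> k j; have /matrixP/(_ k 0) := Ey j; rewrite !mxE => ->.
by apply: eq_bigr => l _; rewrite mxE.
Qed.

Let incl b : 'M[H]_(n, #|b|) := \matrix_(l, j) (l == enum_val j)%:R.

Let incl_out b (y : 'cV_#|b|) l : l \notin b -> (incl b *m y) l 0 = 0.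
Proof.
move=> lb; rewrite mxE big1 // => j _; rewrite mxE.
case: eqP => [e|]; rewrite ?mul0r //.
by rewrite e enum_valP in lb.
Qed.

Let incl_in b (y : 'cV_#|b|) j : (incl b *m y) (enum_val j) 0 = y j 0.
Proof.
rewrite mxE (bigD1 j) //= big1 => [|k kj]; first by rewrite mxE eqxx mul1r addr0.
by rewrite mxE (inj_eq enum_val_inj) eq_sym (negPf kj) mul0r.
Qed.

(** With [A = B *m C], the columns of [C] in [b] have only [r] entries, hence are dependent. *)
Lemma minor_big b : (r < #|b|)%N -> D b = 0.
Proof.
move=> rb; have [B [C [_ [_ AE _]]]] := rank_factor.
have [y y0 Cy] := wide_kernel (C *m incl b) rb.
apply: contra_neq_eq y0 => /indep_cols_minor indb.
have z : incl b *m y = 0.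
  apply: indb; first exact: incl_out.
  by rewrite AE -mulmxA (mulmxA C) Cy mulmx0.
by apply/matrixP=> j k; rewrite ord1 -incl_in z !mxE.
Qed.

(** For a largest [b] with nonzero minor, [minor_eq0_dep] makes all columns of [A] combinations of
    those in [b]. If [b] had fewer than [r] elements, [F *m Y] would have a kernel, against the
    injectivity of [B]. *)
Lemma minor_rank : exists2 b : {set 'I_n}, #|b| = r & D b != 0.
Proof.
have D0 : D set0 != 0.
  rewrite /D (_ : padmx _ _ = 1%:M) ?hermdet1 ?oner_eq0 //.
  by apply/matrixP=> x y; rewrite !mxE !inE.
case: (arg_maxnP (P := fun b => D b != 0) (fun b => #|b|) D0) => b Db bmax.
exists b => //; apply/eqP; rewrite eqn_leq; apply/andP; split.
  by rewrite leqNgt; apply: contraNN Db => /minor_big->.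
rewrite leqNgt; apply/negP=> br.
have [B [C [Y [Binj _ BE]]]] := rank_factor.
have /fin_all_exists[y Ey] j : exists y : 'cV[H]_n,
    (forall l, l \notin b -> y l 0 = 0) /\ col j A = A *m y.
  have [jb|jb] := boolP (j \in b).
    exists (delta_mx j 0); split=> [l lb|]; last by rewrite colE.
    by rewrite mxE andbT; case: eqP => // e; rewrite e jb in lb.
  apply: minor_eq0_dep => //; apply/eqP; apply/negPn/negP => /bmax.
  by rewrite /= cardsU1 jb add1n ltnn.
pose F : 'M[H]_(#|b|, n) := \matrix_(k, j) y j (enum_val k) 0.
have AF : A = A *m incl b *m F.
  apply/matrixP=> k j; have [yb /matrixP/(_ k 0)] := Ey j; rewrite mxE => ->.
  rewrite -mulmxA !mxE; apply: eq_bigr => l _; congr (_ * _).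
  have -> : (incl b *m F) l j = (incl b *m col j F) l 0.
    by rewrite !mxE; apply: eq_bigr => q _; rewrite !mxE.
  have [lb|lb] := boolP (l \in b); last by rewrite yb // incl_out.
  by rewrite -(enum_rankK_in lb lb) incl_in !mxE.
have [z z0 Fz] := wide_kernel (F *m Y) br.
case/eqP: z0; apply: Binj; rewrite BE AF -!mulmxA (mulmxA F) Fz.
by rewrite !mulmx0.
Qed.

Lemma minorsum_big k : (r < k)%N -> minorsum k G = 0.
Proof.
move=> rk; apply: big1 => b; rewrite inE => /eqP bk.
by apply: minor_big; rewrite bk.
Qed.

Lemma minorsum_gt0 : 0 < minorsum r G.
Proof.
have [b br Db] := minor_rank; rewrite /minorsum (bigD1 b) ?inE ?br //=.
apply: ltr_pwDl; first by rewrite lt0r Db minor_ge0.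
by apply: sumr_ge0 => c _; apply: minor_ge0.
Qed.

Hypothesis r_gt0 : (0 < r)%N.

(** Descending induction from [k > n], where there are no index sets. With [minorsum k G = 0], the
    recursion multiplied by [G] gives [adjsum k G *m G *m G = 0], and one factor [G] cancels. *)
Lemma adjsum_gram_big k : (r < k)%N -> adjsum k G *m G = 0.
Proof.
have [d] := ubnP (n.+1 - k); elim: d k => // d IHd k dk rk.
have [kn|kn] := leqP k n; last first.
  suff -> : adjsum k G = 0 by rewrite mul0mx.
  apply/matrixP=> i j; rewrite !mxE big1 // => b; rewrite inE => /andP[/eqP bk _].
  by have := max_card b; rewrite card_ord bk leqNgt kn.
apply: mul_gram2_eq0; rewrite -/G.
have IH : adjsum k.+1 G *m G = 0.
  apply: IHd; last exact: leqW.
  by move: dk; rewrite subSS subSn.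
have k0 : (0 < k)%N by exact: leq_ltn_trans rk.
have /(congr1 (fun M => M *m G)) := adjsum_rec k0 hG.
rewrite mulmxDl IH add0r (minorsum_big rk) !raddf0 mul0mx.
exact.
Qed.

(** The recursion at order [r] times [ctrmx A]: the term of order [r.+1] annihilates [G], hence
    [ctrmx A]. *)
Lemma adjsum_gram : adjsum r G *m G *m ctrmx A = realq (minorsum r G) *: ctrmx A.
Proof.
rewrite -mul_scalar_mx -(adjsum_rec r_gt0 hG) mulmxDl -[LHS]add0r.
by rewrite (mul_gram_eq0 (adjsum_gram_big (ltnSn r))).
Qed.

End Rank.

End PrincipalMinors.

Lemma gram_left_inverse (R : realFieldType) m r (B : 'M[quat R]_(m, r)) :
    (forall x : 'cV_r, B *m x = 0 -> x = 0) ->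
  exists L : 'M[quat R]_(r, m), L *m B = 1%:M.
Proof.
move=> Binj; have D0 : 0 < hermdet (padmx setT (ctrmx B *m B)).
  by apply: minor_pos => x _; apply: Binj.
rewrite padmx_setT in D0.
exists (realq (hermdet (ctrmx B *m B))^-1 *: (adjq (ctrmx B *m B) *m ctrmx B)).
rewrite -scalemxAl -mulmxA mul_adjq ?gram_herm // scale_scalar_mx -rmorphM /=.
by rewrite mulVf ?gt_eqF // rmorph1.
Qed.

(** Row rank equals column rank: in [B = E *m F], [E] has a left inverse [L] and [F] the right
    inverse [Y], so the columns of [ctrmx F] form a basis for [ctrmx B]. *)
Lemma has_rank_ctrmx (R : realFieldType) p q (B : 'M[quat R]_(p, q)) r :
  has_rank B r -> has_rank (ctrmx B) r.
Proof.
case/rank_factor=> E [F [Y [Einj BE EB]]].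
have [L LE] := gram_left_inverse Einj.
have FY : F *m Y = 1%:M.
  by rewrite -[F *m Y]mul1mx -LE -mulmxA (mulmxA E) -BE -EB LE.
exists (ctrmx F); split=> [x Fx|v].
  by rewrite -[x]mul1mx -ctrmx1 -FY ctrmx_mul -mulmxA Fx mulmx0.
have FE : ctrmx F = ctrmx B *m ctrmx L.
  by rewrite BE ctrmx_mul -mulmxA -ctrmx_mul LE ctrmx1 mulmx1.
split=> -[x ->]; first by exists (ctrmx L *m x); rewrite mulmxA -FE.
by exists (ctrmx E *m x); rewrite mulmxA -ctrmx_mul -BE.
Qed.

(** * Normal equations, orthogonality, and entries of the minimum norm solution *)

Section LeastSquares.
Variable R : realFieldType.
Local Notation H := (quat R).

(** The real inner product with squared norm [sqn]; taking the real part makes the trace cyclic. *)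
Definition dotq m n (E F : 'M[H]_(m, n)) : R := q1 (\tr (E *m ctrmx F)).

Lemma q1_sum (I : Type) (r : seq I) (P : pred I) (F : I -> H) :
  q1 (\sum_(i <- r | P i) F i) = \sum_(i <- r | P i) q1 (F i).
Proof. exact: raddf_sum. Qed.

Lemma q1_trC m n (E : 'M[H]_(m, n)) (F : 'M[H]_(n, m)) :
  q1 (\tr (E *m F)) = q1 (\tr (F *m E)).
Proof.
rewrite /mxtrace !q1_sum.
transitivity (\sum_i \sum_j q1 (E i j * F j i)).
  by apply: eq_bigr => i _; rewrite mxE q1_sum.
rewrite exchange_big; apply: eq_bigr => j _; rewrite mxE q1_sum.
by apply: eq_bigr => i _; rewrite q1_mulC.
Qed.

Lemma dotqC m n (E F : 'M[H]_(m, n)) : dotq E F = dotq F E.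
Proof.
rewrite /dotq -[F *m _]ctrmxK ctrmx_mul ctrmxK /mxtrace !q1_sum.
by apply: eq_bigr => i _; rewrite ctrmxE q1_conj.
Qed.

Lemma dotqq m n (E : 'M[H]_(m, n)) : dotq E E = sqn E.
Proof.
rewrite /dotq /mxtrace q1_sum; apply: eq_bigr => i _.
by rewrite mxE q1_sum; apply: eq_bigr => j _; rewrite ctrmxE mulq_conj.
Qed.

Lemma dotqDl m n (E E' F : 'M[H]_(m, n)) : dotq (E + E') F = dotq E F + dotq E' F.
Proof. by rewrite /dotq mulmxDl !raddfD. Qed.

Lemma dotqZl m n t (E F : 'M[H]_(m, n)) : dotq (realq t *: E) F = t * dotq E F.
Proof. by rewrite /dotq -scalemxAl mxtraceZ q1_realqM. Qed.

Lemma sqnD m n t (E F : 'M[H]_(m, n)) :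
  sqn (E + realq t *: F) = sqn E + 2 * t * dotq E F + t ^+ 2 * sqn F.
Proof.
rewrite -!dotqq dotqDl dotqZl (dotqC E) (dotqC F) !dotqDl !dotqZl (dotqC F E).
ring.
Qed.

Lemma dotq_eq0 m n (E F : 'M[H]_(m, n)) :
  (forall t, sqn E <= sqn (E + realq t *: F)) -> dotq E F = 0.
Proof.
move=> minE; set d := dotq E F; pose s := sqn F.
have s0 : 0 <= s by apply: sqn_ge0.
have s1 : s + 1 != 0 by rewrite gt_eqF // ltr_wpDl.
(* Near the minimum of [2 * t * d + t ^+ 2 * s]; dividing by [s + 1] instead of [s] covers [s = 0],
   and the value is still negative unless [d = 0]. *)
have := minE (- d / (s + 1)); rewrite sqnD -/d -/s -addrA lerDl.
have -> : 2 * (- d / (s + 1)) * d + (- d / (s + 1)) ^+ 2 * s =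
          - ((d / (s + 1)) ^+ 2 * (s + 2)) by field.
rewrite oppr_ge0 pmulr_lle0 ?ltr_wpDl // => d0.
have /eqP : (d / (s + 1)) ^+ 2 = 0 by apply/eqP; rewrite eq_le d0 sqr_ge0.
by rewrite sqrf_eq0 mulf_eq0 invr_eq0 (negPf s1) orbF => /eqP.
Qed.

Section Equation.
Variables (m n p q : nat).
Variables (A : 'M[H]_(m, n)) (B : 'M[H]_(p, q)) (D : 'M[H]_(m, q)).
Variable X : 'M[H]_(n, p).

Definition sqn_LS (Z : 'M[H]_(n, p)) := forall Y : 'M[H]_(n, p),
  sqn (A *m Z *m B - D) <= sqn (A *m Y *m B - D).

Hypothesis X_LS : sqn_LS X.
Hypothesis X_min : forall Y, sqn_LS Y -> sqn X <= sqn Y.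

(** The residual [E] is orthogonal to [A *m Y *m B] for every direction [Y]. For the gradient
    [ctrmx A *m E *m ctrmx B] this inner product is [sqn Y]. *)
Lemma LS_normal :
  ctrmx A *m A *m X *m (B *m ctrmx B) = ctrmx A *m D *m ctrmx B.
Proof.
pose E := A *m X *m B - D.
have [Y YE] : exists Y, Y = ctrmx A *m E *m ctrmx B by eexists.
suff Y0 : Y = 0.
  move: Y0; rewrite YE /E mulmxBr mulmxBl !mulmxA => /eqP.
  by rewrite subr_eq0 => /eqP.
apply: sqn_eq0; rewrite -dotqq.
transitivity (dotq E (A *m Y *m B)).
  by rewrite /dotq {1}YE -!mulmxA q1_trC !ctrmx_mul !mulmxA.
apply: dotq_eq0 => t; have := X_LS (X + realq t *: Y); rewrite -/E.
rewrite mulmxDr mulmxDl scale_realqAr -scalemxAl addrAC; exact.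
Qed.

Lemma min_norm_orth Y : A *m Y *m B = 0 -> dotq X Y = 0.
Proof.
move=> AYB; apply: dotq_eq0 => t; apply: X_min => Z.
rewrite mulmxDr mulmxDl scale_realqAr -scalemxAl AYB scaler0 addr0; exact: X_LS.
Qed.

(** Moving [X] along [ctrmx Q *m Q *m X] does not change the residual; the inner product of [X] with
    this direction is [sqn (Q *m X)]. *)
Lemma min_norm_left (Q : 'M[H]_n) :
  Q *m ctrmx A = 0 -> Q *m X = 0.
Proof.
move=> QA; apply: sqn_eq0; rewrite -dotqq.
transitivity (dotq X (ctrmx Q *m Q *m X)).
  by rewrite /dotq !ctrmx_mul ctrmxK -mulmxA q1_trC !mulmxA.
apply: min_norm_orth => //; rewrite !mulmxA -[A]ctrmxK -ctrmx_mul QA raddf0.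
by rewrite !mul0mx.
Qed.

Lemma min_norm_right (Q : 'M[H]_p) :
  Q *m B = 0 -> X *m ctrmx Q = 0.
Proof.
move=> QB; apply: sqn_eq0; rewrite -dotqq.
transitivity (dotq X (X *m ctrmx Q *m Q)).
  by rewrite /dotq !ctrmx_mul ctrmxK !mulmxA.
by apply: min_norm_orth => //; rewrite -!mulmxA QB !mulmx0.
Qed.

Section Ranks.
Variables r1 r2 : nat.
Hypotheses (r1_gt0 : (0 < r1)%N) (r2_gt0 : (0 < r2)%N).
Hypotheses (rkA : has_rank A r1) (rkB : has_rank B r2).

Let AA := ctrmx A *m A.
Let BB := B *m ctrmx B.
Let Dt := ctrmx A *m D *m ctrmx B.
Let K1 := adjsum r1 AA.
Let K2 := adjsum r2 BB.
Let d1 := minorsum r1 AA.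
Let d2 := minorsum r2 BB.

Let hAA : ctrmx AA = AA. Proof. exact: gram_herm. Qed.
Let hBB : ctrmx BB = BB. Proof. by rewrite /BB ctrmx_mul ctrmxK. Qed.

Lemma min_norm_adjsum : K1 *m Dt *m ctrmx K2 = realq (d1 * d2) *: X.
Proof.
(* This [Q] annihilates [ctrmx A] by [adjsum_gram], whence [K1 *m AA *m X = realq d1 *: X]. *)
have := min_norm_left (Q := (realq d1)%:M - K1 *m AA).
rewrite mulmxBl mul_scalar_mx (adjsum_gram rkA r1_gt0) subrr => /(_ erefl).
rewrite mulmxBl mul_scalar_mx => /eqP; rewrite subr_eq0 => /eqP XA.
have rkB' := has_rank_ctrmx rkB.
have BBE : ctrmx (ctrmx B) *m ctrmx B = BB by rewrite ctrmxK.
have := adjsum_gram rkB' r2_gt0; rewrite BBE ctrmxK => KB.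
(* Likewise this [Q] annihilates [B], whence [X *m BB *m ctrmx K2 = realq d2 *: X]. *)
have := min_norm_right (Q := (realq d2)%:M - K2 *m BB).
rewrite mulmxBl mul_scalar_mx KB subrr => /(_ erefl).
rewrite raddfB /= ctrmx_mul hBB -scalemx1 ctrmx_realq ctrmx1 mulmxBr.
rewrite scale_realqAr mulmx1 mulmxA => /eqP; rewrite subr_eq0 => /eqP XB.
rewrite /Dt -LS_normal -/AA -/BB.
rewrite [K1 *m _]mulmxA [K1 *m _]mulmxA -XA -!scalemxAl -XB.
by rewrite scalerA -rmorphM.
Qed.

Lemma d12_neq0 : d1 * d2 != 0.
Proof.
have := minorsum_gt0 rkA; have := minorsum_gt0 (has_rank_ctrmx rkB).
by rewrite ctrmxK -/BB -/d2 -/AA -/d1 => h2 h1; rewrite mulf_neq0 ?gt_eqF.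
Qed.

Lemma entry_quotient (x y : H) (d : R) :
  d != 0 -> x = realq d * y -> y = x / realq d.
Proof.
move=> d0 ->; rewrite realqC mulrK // unitqE; apply: contraNneq d0.
by move=> /(congr1 (@q1 R))/= ->.
Qed.

Lemma sum_rdet_sub (r : nat) (M : 'M[H]_p) j (c : 'rV_p) : ctrmx M = M ->
  \sum_(a in idx_at r j) rdet_sub a j (setrow j c M) =
  (c *m ctrmx (adjsum r M)) 0 j.
Proof.
move=> hM; rewrite -[LHS]conjqK raddf_sum /=.
rewrite (eq_bigr (fun a => cdet_sub a j (setcol j (ctrmx c) M))) => [|a _].
  by rewrite sum_cdet_sub // -ctrmxE ctrmx_mul ctrmxK.
by rewrite conjq_rdet_sub ctrmx_setrow hM.
Qed.

Lemma dB_col j : dB r2 BB Dt j = col j (Dt *m ctrmx K2).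
Proof.
apply/matrixP=> k z; rewrite mxE sum_rdet_sub //.
by rewrite -row_mul !mxE.
Qed.

Lemma dA_row i : dA r1 AA Dt i = row i (K1 *m Dt).
Proof.
apply/matrixP=> z l; rewrite mxE sum_cdet_sub // [RHS]mxE.
by rewrite [LHS]mxE [RHS]mxE; apply: eq_bigr => k _; rewrite [col _ _ _ _]mxE.
Qed.

(** The two formulas are the two bracketings of [K1 *m Dt *m ctrmx K2]. All four cases of the
    theorem are derived from this one. *)
Lemma min_norm_entry i j :
  X i j =
    (\sum_(b in idx_at r1 i) cdet_sub b i (setcol i (dB r2 BB Dt j) AA))
    / ((\sum_(b in idx r1 n) hdet (psubmx b AA))
       * (\sum_(a in idx r2 p) hdet (psubmx a BB)))
  /\
  X i j =
    (\sum_(a in idx_at r2 j) rdet_sub a j (setrow j (dA r1 AA Dt i) BB))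
    / ((\sum_(b in idx r1 n) hdet (psubmx b AA))
       * (\sum_(a in idx r2 p) hdet (psubmx a BB))).
Proof.
rewrite !sum_hdet // -rmorphM.
have E : (K1 *m Dt *m ctrmx K2) i j = realq (d1 * d2) * X i j.
  by rewrite min_norm_adjsum mxE.
split; apply: (entry_quotient d12_neq0); rewrite -E.
  rewrite sum_cdet_sub // dB_col -mulmxA [LHS]mxE [RHS]mxE.
  by apply: eq_bigr => k _; rewrite [col _ _ _ _]mxE.
by rewrite sum_rdet_sub // dA_row -row_mul [LHS]mxE.
Qed.

End Ranks.
End Equation.

(** * Full rank: the sums over index sets collapse to one term *)

Section FullRank.
Variable n : nat.
Implicit Types (M : 'M[H]_n) (i : 'I_n).

Lemma idx_full : idx n n = [set [set: 'I_n]].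
Proof.
apply/setP=> b; rewrite !inE eqEcard subsetT cardsT card_ord /= eqn_leq.
by have := max_card b; rewrite card_ord => ->.
Qed.

Lemma idx_at_full i : idx_at n i = [set [set: 'I_n]].
Proof.
rewrite -idx_full; apply/setP=> b; have := set11 [set: 'I_n]; rewrite -idx_full.
rewrite [in RHS]idx_full !inE; have [->|bT] := eqVneq b setT.
  by rewrite inE andbT => ->.
by move=> _; apply: contraNF bT => /andP[bn _]; rewrite -in_set1 -idx_full inE.
Qed.

Lemma sum_cdet_sub_full M i : \sum_(b in idx_at n i) cdet_sub b i M = cdet i M.
Proof. by rewrite idx_at_full big_set1 cdet_subT. Qed.

Lemma sum_rdet_sub_full M i : \sum_(b in idx_at n i) rdet_sub b i M = rdet i M.
Proof.
rewrite idx_at_full big_set1 -[LHS]conjqK conjq_rdet_sub cdet_subT.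
by rewrite -conjq_rdet conjqK.
Qed.

Lemma sum_hdet_full M i : ctrmx M = M ->
  \sum_(b in idx n n) hdet (psubmx b M) = hdet M.
Proof.
move=> hM; rewrite idx_full big_set1 (hdet_psubmx (i := i)) ?inE //.
by rewrite padmx_setT hdet_hermdet.
Qed.

Lemma dB_full m (G : 'M[H]_n) (Dt : 'M[H]_(m, n)) i : dB n G Dt i = dBfull G Dt i.
Proof. by apply/matrixP=> k z; rewrite !mxE sum_rdet_sub_full. Qed.

Lemma dA_full m (G : 'M[H]_n) (Dt : 'M[H]_(n, m)) i : dA n G Dt i = dAfull G Dt i.
Proof. by apply/matrixP=> k z; rewrite !mxE sum_cdet_sub_full. Qed.

End FullRank.
End LeastSquares.

Lemma frob_le (R : realType) m n p q (E : 'M[quat R]_(m, n))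
    (F : 'M[quat R]_(p, q)) :
  (frob E <= frob F) = (sqn E <= sqn F).
Proof. by rewrite ler_sqrt // sqn_ge0. Qed.

Theorem theorem4p6 (R : realType) (m n p q : nat)
  (A : 'M[quat R]_(m, n)) (B : 'M[quat R]_(p, q)) (D : 'M[quat R]_(m, q))
  (X : 'M[quat R]_(n, p)) (hX : is_min_norm_LS A B D X) :
  let AA := ctrmx A *m A in
  let BB := B *m ctrmx B in
  let Dt := ctrmx A *m D *m ctrmx B in
  (* (i) *)
  (forall r1 r2 : nat, (0 < r1)%N -> (0 < r2)%N ->
     has_rank A r1 -> (r1 < m)%N -> has_rank B r2 -> (r2 < p)%N ->
     forall (i : 'I_n) (j : 'I_p),
       X i j =
         (\sum_(b in idx_at r1 i) cdet_sub b i (setcol i (dB r2 BB Dt j) AA))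
         / ((\sum_(b in idx r1 n) hdet (psubmx b AA))
            * (\sum_(a in idx r2 p) hdet (psubmx a BB)))
       /\
       X i j =
         (\sum_(a in idx_at r2 j) rdet_sub a j (setrow j (dA r1 AA Dt i) BB))
         / ((\sum_(b in idx r1 n) hdet (psubmx b AA))
            * (\sum_(a in idx r2 p) hdet (psubmx a BB))))
  /\
  (* (ii) *)
  (has_rank A n -> has_rank B p ->
     forall (i : 'I_n) (j : 'I_p),
       X i j = cdet i (setcol i (dBfull BB Dt j) AA) / (hdet AA * hdet BB)
       /\
       X i j = rdet j (setrow j (dAfull AA Dt i) BB) / (hdet AA * hdet BB))
  /\
  (* (iii) *)
  (forall r2 : nat, (0 < r2)%N ->
     has_rank A n -> has_rank B r2 -> (r2 < p)%N ->
     forall (i : 'I_n) (j : 'I_p),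
       X i j =
         cdet i (setcol i (dB r2 BB Dt j) AA)
         / (hdet AA * (\sum_(a in idx r2 p) hdet (psubmx a BB)))
       /\
       X i j =
         (\sum_(a in idx_at r2 j) rdet_sub a j (setrow j (dAfull AA Dt i) BB))
         / (hdet AA * (\sum_(a in idx r2 p) hdet (psubmx a BB))))
  /\
  (* (iiii) *)
  (forall r1 : nat, (0 < r1)%N ->
     has_rank A r1 -> (r1 < n)%N -> has_rank B p ->
     forall (i : 'I_n) (j : 'I_p),
       X i j =
         rdet j (setrow j (dA r1 AA Dt i) BB)
         / ((\sum_(b in idx r1 n) hdet (psubmx b AA)) * hdet BB)
       /\
       X i j =
         (\sum_(b in idx_at r1 i) cdet_sub b i (setcol i (dBfull BB Dt j) AA))
         / ((\sum_(b in idx r1 n) hdet (psubmx b AA)) * hdet BB)).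
Proof.
move=> AA BB Dt.
have LSE Y : is_LS A B D Y <-> sqn_LS A B D Y.
  by split=> h Z; have := h Z; rewrite frob_le.
have X_LS := (LSE X).1 hX.1.
have X_min Y : sqn_LS A B D Y -> sqn X <= sqn Y.
  by move/LSE/(hX.2 Y); rewrite frob_le.
have hAA : ctrmx AA = AA by apply: gram_herm.
have hBB : ctrmx BB = BB by rewrite /BB ctrmx_mul ctrmxK.
(* In the full rank cases, the indices [i] and [j] themselves witness that the ranks are
   positive. *)
have pos k (l : 'I_k) : (0 < k)%N by apply: leq_ltn_trans (ltn_ord l).
split=> [r1 r2 r1_gt0 r2_gt0 rkA _ rkB _ i j|]; first exact: min_norm_entry.
split=> [rkA rkB i j|].
  have := min_norm_entry X_LS X_min (pos _ i) (pos _ j) rkA rkB i j.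
  by rewrite sum_cdet_sub_full sum_rdet_sub_full dB_full dA_full
    (sum_hdet_full i) // (sum_hdet_full j).
split=> [r2 r2_gt0 rkA rkB _ i j|r1 r1_gt0 rkA _ rkB i j].
  have := min_norm_entry X_LS X_min (pos _ i) r2_gt0 rkA rkB i j.
  by rewrite sum_cdet_sub_full dA_full (sum_hdet_full i).
(* In (iiii) the row formula comes first, so the two conjuncts are swapped. *)
have := min_norm_entry X_LS X_min r1_gt0 (pos _ j) rkA rkB i j.
by rewrite sum_rdet_sub_full dB_full (sum_hdet_full j) // => -[].
Qed.
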